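(* Let $S$ be a locally compact Hausdorff semitopological semigroup. The following statements are equivalent: (1) $M(S)^*$ has a topologically left invariant mean; (2) for any separately continuous right action $T : M(S) \times M(S)^* \to M(S)^*$ of $M(S)$ on $M(S)^*$ (where $M(S)$ has the topology $\sigma(M(S), M(S)^* )$ and $M(S)^*$ has the weak topology) and any $M_0(S)$-invariant linear subspace $X$ of $M(S)^*$ containing $1$, any $M_0(S)$-invariant mean $M$ on $X$ can be extended to an $M_0(S)$-invariant mean $\mathcal{M}$ on $M(S)^*$ (where invariance is with respect to the action $T$).
   Context: A semitopological semigroup is a semigroup with a topology in which multiplication is separately continuous. $M(S)$ is the Banach algebra of all bounded regular (complex) Borel measures on $S$ with total variation norm and convolution $*$ as multiplication, where $\int g\, d(\mu*\nu) = \int\int g(xy)\, d\mu(x)\, d\nu(y)$ for $g \in C_0(S)$. $M_0(S)$ is the set of probability measures in $M(S)$. $M(S)^*$ and $M(S)^{**}$ are the first and second Banach space duals; the weak topology on $M(S)^*$ is $\sigma(M(S)^*, M(S)^{**})$. For $f \in M(S)^*$ and $\mu \in M(S)$, the functional $f\mu \in M(S)^*$ is defined by $\langle f\mu, \lambda\rangle = \langle f, \mu * \lambda\rangle$ for $\lambda \in M(S)$. The element $1 \in M(S)^*$ is defined by $\langle 1, \mu\rangle = \mu(S)$. For $f\in M(S)^*$, $f \ge 0$ means $\langle f,\mu\rangle \ge 0$ for every positive measure $\mu \in M(S)$. For a linear subspace $X$ of $M(S)^*$ with $1 \in X$, an element $M \in X^*$ is a mean on $X$ if $\langle M, f\rangle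 \ge 0$ whenever $f \in X$, $f \ge 0$, and $\langle M, 1\rangle = 1$. A mean $M$ on $M(S)^*$ is topologically left invariant if $\langle M, f\mu\rangle = \langle M, f\rangle$ for all $\mu \in M_0(S)$ and $f \in M(S)^*$. A right action of $M(S)$ on $M(S)^*$ is a map $T : M(S) \times M(S)^* \to M(S)^*$, denoted $(\mu, f) \mapsto T_\mu(f)$, such that: (i) $(\mu, f) \mapsto T_\mu(f)$ is bilinear and $T_{\mu * \nu} = T_\nu \circ T_\mu$ for any $\mu, \nu \in M(S)$; (ii) for any $\mu \in M_0(S)$, $T_\mu : M(S)^* \to M(S)^*$ is a positive linear operator and $T_\mu(1) = 1$. A linear subspace $X$ of $M(S)^*$ is $M_0(S)$-invariant under the right action $T$ if $T_\mu(X) \subseteq X$ for any $\mu \in M_0(S)$. A mean $M$ on $X$ is $M_0(S)$-invariant under the right action $T$ if $\langle M, T_\mu(f)\rangle = \langle M, f\rangle$ for any $\mu \in M_0(S)$ and $f \in X$.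
   Formalization: In (2), X is also required to be self-adjoint (closed under f ↦ f*, ⟨f*,μ⟩ = conj⟨f, conj μ⟩); with complex scalars the claim fails otherwise, e.g. S = Z/3, T_μ f = μ(S)f, X = span(1,(1,i,0)), M(a+bh) = a+100b. *)

(* Defs.v *)
From HB Require Import structures.
From mathcomp Require Import all_boot all_order all_algebra.
From mathcomp Require Import all_classical all_reals all_analysis.
From mathcomp.real_closed Require Import complex.
Import Order.TTheory GRing.Theory Num.Theory.
Import numFieldNormedType.Exports ComplexField.Normc.
Set Implicit Arguments.
Unset Strict Implicit.
Unset Printing Implicit Defensive.
Local Open Scope classical_set_scope.
Local Open Scope ring_scope.
Local Open Scope complex_scope.

(* The library puts the topology and the norm of R[i] on its copy R[i]^o. *)
Notation Cplx R := (R[i]^o)%type.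

Section complex_facts.
Variable R : realType.
Implicit Types z : R[i].

Lemma normCE z : `|z| = (normc z)%:C. Proof. by []. Qed.

Lemma lerC (a b : R) : (a%:C <= b%:C) = (a <= b).
Proof. by rewrite lecR. Qed.

Lemma normc_nonneg z : 0 <= normc z.
Proof. by rewrite -lerC -normCE normr_ge0. Qed.

Lemma normcD z1 z2 : normc (z1 + z2) <= normc z1 + normc z2.
Proof. by rewrite -lerC rmorphD /= -!normCE; exact: ler_normD. Qed.

Lemma normc0_eq0 z : normc z = 0 -> z = 0.
Proof. by move=> h; apply/eqP; rewrite -normr_eq0 normCE h. Qed.

Lemma normc_zero : normc (0 : R[i]) = 0.
Proof. by apply/eqP; rewrite -(inj_eq (@complexI R)) -normCE normr0. Qed.

Lemma normc_conj z : normc (z^*) = normc z.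
Proof. by case: z => a b /=; rewrite sqrrN. Qed.

Lemma normc_Re z : `|complex.Re z| <= normc z.
Proof.
case: z => a b /=; rewrite -sqrtr_sqr ler_wsqrtr// lerDl sqr_ge0 //.
Qed.

Lemma normc_Im z : `|complex.Im z| <= normc z.
Proof.
case: z => a b /=; rewrite -sqrtr_sqr ler_wsqrtr// lerDr sqr_ge0 //.
Qed.

End complex_facts.

Section measures.
Variables (R : realType) (S : ptopologicalType).
Local Notation C := (Cplx R).
Local Notation borel := ((@open S).-sigma.-measurable).
Implicit Types (m : set S -> C) (A B : set S).

(* |m|(A), from finite families of disjoint Borel subsets of A. *)
Definition total_variation m A : \bar R :=
  ereal_sup [set x | exists n (F : 'I_n -> set S),
    [/\ forall i, borel (F i), forall i, F i `<=` A, trivIset setT F &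
        x = (\sum_(i < n) normc (m (F i)))%:E]].

Definition complex_sigma_additive m := forall F : nat -> set S,
  (forall i, borel (F i)) -> trivIset setT F ->
  (fun n => \sum_(i < n) m (F i)) @ \oo --> m (\bigcup_i F i).

Definition regular_variation m := forall A, borel A ->
  forall e : R, 0 < e -> exists K U,
    [/\ compact K, open U, K `<=` A, A `<=` U &
        (total_variation m (U `\` K) < e%:E)%E].

(* Set functions are total, so the value 0 is imposed off the Borel sets to
   make equality of measures the equality of set functions. *)
Definition is_regular_measure m :=
  [/\ forall A, ~ borel A -> m A = 0,
      complex_sigma_additive m,
      (total_variation m setT < +oo)%E &
      regular_variation m].

Definition regular_measure_pred : {pred set S -> C} :=
  [pred m : set S -> C | `[< is_regular_measure m >]].

Lemma tv_ge0 m A : (0 <= total_variation m A)%E.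
Proof.
apply: ereal_sup_ubound; exists 0, (fun=> set0).
by split=> //; [case|case|rewrite big_ord0].
Qed.

Lemma tv_subset m A B : A `<=` B ->
  (total_variation m A <= total_variation m B)%E.
Proof.
move=> AB; apply: le_ereal_sup => _ [n [F [mF FA tF ->]]].
by exists n, F; split=> // i; apply: subset_trans AB; exact: FA.
Qed.

Lemma tvD m1 m2 A : (total_variation (m1 + m2)%R A <=
  total_variation m1 A + total_variation m2 A)%E.
Proof.
apply: ge_ereal_sup => _ [n [F [mF FA tF ->]]].
apply: (@le_trans _ _ ((\sum_(i < n) normc (m1 (F i)))%:E +
                       (\sum_(i < n) normc (m2 (F i)))%:E)%E).
  rewrite -EFinD lee_fin -big_split /=; apply: ler_sum => i _.
  exact: normcD.
by apply: leeD; apply: ereal_sup_ubound; exists n, F.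
Qed.

Lemma tvZ_le (a : C) m A :
  (total_variation (a *: m)%R A <= (normc a)%:E * total_variation m A)%E.
Proof.
apply: ge_ereal_sup => _ [n [F [mF FA tF ->]]].
rewrite (_ : \sum_(i < n) _ = normc a * \sum_(i < n) normc (m (F i))); last first.
  by rewrite mulr_sumr; apply: eq_bigr => i _; rewrite -normcM.
rewrite EFinM; apply: lee_wpmul2l; first by rewrite lee_fin normc_nonneg.
by apply: ereal_sup_ubound; exists n, F.
Qed.

Lemma tv_le m1 m2 A : (forall B, normc (m1 B) = normc (m2 B)) ->
  total_variation m1 A = total_variation m2 A.
Proof.
move=> h; congr ereal_sup; apply/seteqP; split=> _ [n [F [mF FA tF ->]]];
  exists n, F; split=> //; congr EFin; by apply: eq_bigr => i _; rewrite h.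
Qed.

Lemma normc_le_tv m A B : borel B -> B `<=` A ->
  ((normc (m B))%:E <= total_variation m A)%E.
Proof.
move=> mB BA; apply: ereal_sup_ubound; exists 1%N, (fun=> B); split=> //.
  by move=> i j _ _ _; rewrite (ord1 i) (ord1 j).
by rewrite big_ord1.
Qed.

Fact regular_measure_submod : submod_closed regular_measure_pred.
Proof.
split.
  apply/asboolP; split=> //.
  - move=> F _ _; rewrite (_ : (fun _ => _) = (fun=> 0 : C)); first exact: cvg_cst.
    by apply/funext => n; rewrite big1.
  - apply: le_lt_trans (ltry 0); apply: ge_ereal_sup => _ [n [F [_ _ _ ->]]].
    by rewrite big1// => i _; rewrite normc_zero.
  - move=> A mA e e0.
    have [] : exists K U : set S, [/\ compact K, open U, K `<=` A & A `<=` U].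
      exists set0, setT; split=> //; [exact: compact0|exact: openT].
    move=> K [U [cK oU KA AU]]; exists K, U; split=> //.
    apply: le_lt_trans (_ : 0 < e%:E)%E; last by rewrite lte_fin.
    apply: ge_ereal_sup => _ [n [F [_ _ _ ->]]].
    by rewrite big1// => i _; rewrite normc_zero.
move=> a m1 m2 /asboolP[n1 s1 b1 r1] /asboolP[n2 s2 b2 r2].
have tvDZ A : (total_variation (a *: m1 + m2)%R A <=
    (normc a)%:E * total_variation m1 A + total_variation m2 A)%E.
  by apply: le_trans (tvD _ _ _) _; apply: leeD => //; exact: tvZ_le.
apply/asboolP; split.
- by move=> A nA; rewrite /= !fctE n1// n2// scaler0 addr0.
- move=> F mF tF.
  rewrite (_ : (fun _ => _) = (fun n => a *: (\sum_(i < n) m1 (F i)) : C)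
      \+ (fun n => \sum_(i < n) m2 (F i) : C)); last first.
    by apply/funext => n /=; rewrite scaler_sumr -big_split.
  apply: cvgD; last exact: s2.
  by apply: cvgZl_tmp; exact: s1.
- apply: le_lt_trans (tvDZ _) _; rewrite lte_add_pinfty//.
  by rewrite lte_mul_pinfty// lee_fin normc_nonneg.
- move=> A mA e e0.
  have a0 : 0 < normc a + 1 by rewrite ltr_wpDl// normc_nonneg.
  have e1 : 0 < e / 2 / (normc a + 1) by rewrite !divr_gt0.
  have e2 : 0 < e / 2 by rewrite divr_gt0.
  have [K1 [U1 [cK1 oU1 KA1 AU1 h1]]] := r1 A mA _ e1.
  have [K2 [U2 [cK2 oU2 KA2 AU2 h2]]] := r2 A mA _ e2.
  exists (K1 `|` K2), (U1 `&` U2); split.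
  + exact: compactU.
  + exact: openI.
  + by rewrite subUset.
  + by rewrite subsetI.
  + apply: le_lt_trans (tvDZ _) _.
    have -> : e%:E = ((e/2)%:E + (e/2)%:E)%E by rewrite -EFinD -splitr.
    have s1' : (U1 `&` U2) `\` (K1 `|` K2) `<=` U1 `\` K1.
      by move=> x [[? ?] /not_orP[? ?]].
    have s2' : (U1 `&` U2) `\` (K1 `|` K2) `<=` U2 `\` K2.
      by move=> x [[? ?] /not_orP[? ?]].
    apply: lteD.
    * apply: (@le_lt_trans _ _ ((normc a)%:E * (e / 2 / (normc a + 1))%:E)%E).
        apply: lee_wpmul2l; first by rewrite lee_fin normc_nonneg.
        apply: le_trans (ltW h1); exact: tv_subset.
      rewrite -EFinM lte_fin mulrCA gtr_pMr//.
      by rewrite ltr_pdivrMr// mul1r ltrDl.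
    * apply: le_lt_trans h2; exact: tv_subset.
Qed.

HB.instance Definition _ := GRing.isSubmodClosed.Build C (set S -> C)
  regular_measure_pred regular_measure_submod.

Record regular_measure := RegularMeasure {
  measure_fun :> set S -> C;
  regular_measureP : measure_fun \in regular_measure_pred }.

HB.instance Definition _ := [isSub for measure_fun].
HB.instance Definition _ := [Choice of regular_measure by <:].
HB.instance Definition _ := [SubChoice_isSubLmodule of regular_measure by <:].

Implicit Types mu nu : regular_measure.

Lemma regular_measure_prop mu : is_regular_measure mu.
Proof. exact/asboolP/regular_measureP. Qed.

Definition measure_norm mu : C := (fine (total_variation mu setT))%:C.

Lemma tv_fin mu : total_variation mu setT \is a fin_num.
Proof.
rewrite ge0_fin_numE ?tv_ge0//; by have [] := regular_measure_prop mu.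
Qed.

Fact measure_normD mu nu :
  measure_norm (mu + nu) <= measure_norm mu + measure_norm nu.
Proof.
rewrite /measure_norm -rmorphD lerC -fineD ?tv_fin//.
apply: fine_le; rewrite ?fin_numD ?tv_fin//; exact: tvD.
Qed.

Lemma measure_normZ_le (a : R[i]) mu :
  measure_norm (a *: mu) <= `|a| * measure_norm mu.
Proof.
rewrite normCE /measure_norm -rmorphM lerC.
rewrite (_ : normc a * _ = fine ((normc a)%:E * total_variation mu setT)%E).
  apply: fine_le; rewrite ?fin_numM ?tv_fin//; exact: tvZ_le.
by rewrite fineM ?tv_fin.
Qed.

Fact measure_normZ (a : R[i]) mu :
  measure_norm (a *: mu) = `|a| * measure_norm mu.
Proof.
apply/eqP; rewrite eq_le measure_normZ_le /=.
have [->|a0] := eqVneq a 0.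
  by rewrite normr0 mul0r /measure_norm -[0]/(0%:C) lerC fine_ge0// tv_ge0.
rewrite -ler_pdivlMl ?normr_gt0// -normfV.
by rewrite -{1}(scale1r mu) -(mulVf a0) -scalerA measure_normZ_le.
Qed.

Fact measure_norm_eq0 mu : measure_norm mu = 0 -> mu = 0.
Proof.
move=> /complexI h; apply/val_inj/funext => A /=.
have [n0 _ _ _] := regular_measure_prop mu.
have [mA|nA] := pselect (borel A); last exact: n0.
apply: normc0_eq0; apply/eqP; rewrite eq_le normc_nonneg andbT -lee_fin.
have -> : 0%:E = total_variation mu setT by rewrite -(fineK (tv_fin mu)) h.
exact: normc_le_tv.
Qed.

HB.instance Definition _ := Lmodule_isNormed.Build R[i] regular_measure
  measure_normD measure_normZ measure_norm_eq0.

Fact conj_measure_subproof mu :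
  (fun A => (mu A)^* : C) \in regular_measure_pred.
Proof.
have [n0 s b r] := regular_measure_prop mu.
have tvE A : total_variation (fun A => (mu A)^* : C) A = total_variation mu A.
  by apply: tv_le => B; rewrite normc_conj.
apply/asboolP; split.
- by move=> A /n0 ->; rewrite conjc0.
- move=> F mF tF; apply/cvgrPdist_lt => e e0.
  have /cvgrPdist_lt/(_ e e0) := s F mF tF.
  apply: filterS => n; rewrite -[X in _ -> `|_ - X| < _](rmorph_sum (@conjc R)).
  by rewrite -rmorphB /= 2!normCE normc_conj.
- by rewrite tvE.
- move=> A mA e e0; have [K [U [? ? ? ? h]]] := r A mA e e0.
  by exists K, U; split=> //; rewrite tvE.
Qed.

Definition conj_measure mu : regular_measure :=
  RegularMeasure (conj_measure_subproof mu).

Definition positive_measure mu := forall A, 0 <= mu A.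

Definition probability_measures : set regular_measure :=
  [set mu | positive_measure mu /\ mu setT = 1].

End measures.

Section dual_space.
Variables (R : realType) (V : normedModType R[i]).
Local Notation C := (Cplx R).
Implicit Types (f g : V -> C) (x y : V).

Definition bounded_linear_functional f :=
  (forall (a : C) x y, f (a *: x + y) = a * f x + f y) /\
  exists k : R, forall x, `|f x| <= k%:C * `|x|.

Definition dual_pred : {pred V -> C} :=
  [pred f : V -> C | `[< bounded_linear_functional f >]].

Fact dual_submod : submod_closed dual_pred.
Proof.
split.
  apply/asboolP; split; first by move=> a x y; rewrite mulr0 addr0.
  by exists 0 => x; rewrite normr0 mul0r.
move=> a f g /asboolP[lf [kf bf]] /asboolP[lg [kg bg]]; apply/asboolP; split.
  move=> b x y; change (a * f (b *: x + y) + g (b *: x + y) =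
    b * (a * f x + g x) + (a * f y + g y)).
  by rewrite lf lg !mulrDr addrACA mulrCA.
exists (normc a * kf + kg) => x; rewrite rmorphD rmorphM mulrDl.
apply: le_trans (ler_normD _ _) _; apply: lerD => //.
by rewrite normrM -mulrA ler_wpM2l.
Qed.

HB.instance Definition _ := GRing.isSubmodClosed.Build C (V -> C)
  dual_pred dual_submod.

Record topdual := Dual { dual_fun :> V -> C; dualP : dual_fun \in dual_pred }.

HB.instance Definition _ := [isSub for dual_fun].
HB.instance Definition _ := [Choice of topdual by <:].
HB.instance Definition _ := [SubChoice_isSubLmodule of topdual by <:].

Implicit Types phi psi : topdual.

Lemma dual_linear phi (a : C) x y : phi (a *: x + y) = a * phi x + phi y.
Proof. by have /asboolP[l _] := dualP phi; exact: l. Qed.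

Lemma dual0 phi : phi 0 = 0.
Proof.
have := dual_linear phi 1 0 0; rewrite scale1r addr0 mul1r => h.
by apply: (addrI (phi 0)); rewrite -h addr0.
Qed.

Lemma dualZ phi (a : C) x : phi (a *: x) = a * phi x.
Proof. by rewrite -[a *: x]addr0 dual_linear dual0 addr0. Qed.

Definition unit_ball_values phi : set R :=
  [set normc (phi x) | x in [set x : V | `|x| <= 1]].

Definition dual_norm phi : C := (sup (unit_ball_values phi))%:C.

Lemma dual_has_sup phi : has_sup (unit_ball_values phi).
Proof.
split; first by exists (normc (phi 0)), 0 => //=; rewrite normr0.
have /asboolP[_ [k bk]] := dualP phi.
exists `|k| => _ [x /= x1 <-]; rewrite -lerC -normCE.
apply: le_trans (bk x) _; apply: (@le_trans _ _ (`|k|%:C * `|x|)).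
  by rewrite ler_wpM2r// lerC ler_norm.
by rewrite ler_piMr// ?lerC.
Qed.

Lemma dual_norm_bound phi x : `|phi x| <= dual_norm phi * `|x|.
Proof.
have [->|x0] := eqVneq x 0; first by rewrite dual0 !normr0 mulr0.
have nx : 0 < `|x| by rewrite normr_gt0.
rewrite -ler_pdivrMr// -[leLHS]mulrC -[X in X * _]ger0_norm ?invr_ge0//.
rewrite -normrM -dualZ normCE lerC; apply: ub_le_sup.
  by have [] := dual_has_sup phi.
exists (`|x|^-1 *: x) => //=.
by rewrite normrZ ger0_norm ?invr_ge0// mulVf// normr_eq0.
Qed.

Lemma dual_norm_le phi (k : R) :
  (forall x, `|x| <= 1 -> `|phi x| <= k%:C) -> dual_norm phi <= k%:C.
Proof.
move=> h; rewrite lerC; apply: ge_sup; first by have [] := dual_has_sup phi.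
by move=> _ [x x1 <-]; rewrite -lerC -normCE; exact: h.
Qed.

Lemma dual_norm_ge0 phi : 0 <= dual_norm phi.
Proof.
rewrite -[0]/(0%:C) lerC; apply: (@le_trans _ _ (normc (phi 0))).
  exact: normc_nonneg.
by apply: ub_le_sup; [have [] := dual_has_sup phi|exists 0; rewrite //= normr0].
Qed.

Fact dual_normD phi psi :
  dual_norm (phi + psi) <= dual_norm phi + dual_norm psi.
Proof.
rewrite [leRHS](_ : _ = (sup (unit_ball_values phi) +
  sup (unit_ball_values psi))%:C); last by rewrite rmorphD.
apply: dual_norm_le => x x1; rewrite rmorphD.
apply: le_trans (ler_normD (phi x) (psi x)) _.
apply: lerD; apply: le_trans (dual_norm_bound _ _) _;
  by rewrite ler_piMr// dual_norm_ge0.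
Qed.

Lemma dual_normZ_le (a : R[i]) phi :
  dual_norm (a *: phi) <= `|a| * dual_norm phi.
Proof.
rewrite normCE /dual_norm -rmorphM; apply: dual_norm_le => x x1.
rewrite [leRHS](_ : _ = `|a| * dual_norm phi); last first.
  by rewrite /dual_norm rmorphM.
rewrite (_ : (a *: phi) x = a * phi x)// normrM ler_wpM2l//.
by apply: le_trans (dual_norm_bound _ _) _; rewrite ler_piMr// dual_norm_ge0.
Qed.

Fact dual_normZ (a : R[i]) phi : dual_norm (a *: phi) = `|a| * dual_norm phi.
Proof.
apply/eqP; rewrite eq_le dual_normZ_le /=.
have [->|a0] := eqVneq a 0; first by rewrite normr0 mul0r dual_norm_ge0.
rewrite -ler_pdivlMl ?normr_gt0// -normfV.
by rewrite -{1}(scale1r phi) -(mulVf a0) -scalerA dual_normZ_le.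
Qed.

Fact dual_norm_eq0 phi : dual_norm phi = 0 -> phi = 0.
Proof.
move=> h; apply/val_inj/funext => x /=; apply/eqP.
have := dual_norm_bound phi x; rewrite h mul0r normr_le0; exact.
Qed.

HB.instance Definition _ := Lmodule_isNormed.Build R[i] topdual
  dual_normD dual_normZ dual_norm_eq0.

(* sigma(V, V^* ): the initial topology of the embedding of V into the product
   of copies of the scalar field indexed by V^*. *)
Definition weak_topology : topologicalType :=
  initial_topology (fun x => (fun phi => phi x) : {ptws topdual -> C}).

End dual_space.
Arguments topdual {R} V.
Arguments weak_topology {R} V.

Section integral.
Variables (R : realType) (S : ptopologicalType).
Local Notation C := (Cplx R).
Local Notation M := (regular_measure R S).
Local Notation borelType := (g_sigma_algebraType (@open S)).
Implicit Types mu nu : M.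

Lemma measure_set0 mu : mu set0 = 0.
Proof.
have [_ s _ _] := regular_measure_prop mu.
have tF : trivIset setT (fun _ : nat => set0 : set S) by exact: trivIset_set0.
have /= h := s (fun=> set0) (fun=> measurable0) tF.
rewrite bigcup0// in h.
have {}h : (fun n : nat => (mu set0 : C) *+ n) @ \oo --> (mu set0 : C).
  by move: h; under eq_fun do rewrite sumr_const card_ord.
have h' : (fun n : nat => (mu set0 : C) *+ n.+1) @ \oo --> (mu set0 : C).
  by move: h; rewrite -(cvg_shiftS (fun n : nat => (mu set0 : C) *+ n)).
have e : (fun n : nat => (mu set0 : C) *+ n.+1) \-
    (fun n : nat => (mu set0 : C) *+ n) = (fun=> mu set0).
  by apply/funext => n /=; rewrite mulrSr addrAC subrr add0r.
have : ((fun n : nat => (mu set0 : C) *+ n.+1) \-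
    (fun n : nat => (mu set0 : C) *+ n)) @ \oo --> mu set0 - mu set0.
  exact: cvgB.
rewrite e subrr => h0.
by apply: (cvg_unique (@norm_hausdorff _ C) _ h0); exact: cvg_cst.
Qed.

Definition re_charge mu (A : set borelType) : \bar R := (complex.Re (mu A))%:E.
Definition im_charge mu (A : set borelType) : \bar R := (complex.Im (mu A))%:E.

Section part_charge.
Variables (p : {additive R[i] -> R}) (p_le : forall z, `|p z| <= normc z).

Lemma part_sigma_additive mu :
  semi_sigma_additive (fun A : set borelType => (p (mu A))%:E).
Proof.
move=> F mF tF mUF; have [_ s _ _] := regular_measure_prop mu.
rewrite [X in X @ _ --> _](_ : _ =
    EFin \o (fun n => p (\sum_(i < n) mu (F i)))); last first.
  by apply/funext => n /=; rewrite big_mkord (raddf_sum p) sumEFin.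
apply: cvg_EFin; first exact: nearW.
apply/cvgrPdist_lt => e e0.
have e0' : 0 < e%:C by rewrite -[0]/(0%:C) ltcR.
have /cvgrPdist_lt/(_ _ e0') := s F mF tF.
apply: filterS => n; rewrite normCE ltcR /= -raddfB.
exact: le_lt_trans (p_le _).
Qed.

End part_charge.

Fact re_charge_sigma_additive mu : semi_sigma_additive (re_charge mu).
Proof. by apply: part_sigma_additive => z; exact: normc_Re. Qed.

Fact im_charge_sigma_additive mu : semi_sigma_additive (im_charge mu).
Proof. by apply: part_sigma_additive => z; exact: normc_Im. Qed.

Fact re_charge0 mu : re_charge mu set0 = 0%E.
Proof. by rewrite /re_charge measure_set0. Qed.

Fact im_charge0 mu : im_charge mu set0 = 0%E.
Proof. by rewrite /im_charge measure_set0. Qed.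

HB.instance Definition _ mu := isCharge.Build _ borelType R (re_charge mu)
  (re_charge0 mu) (fun _ _ => erefl) (@re_charge_sigma_additive mu).
HB.instance Definition _ mu := isCharge.Build _ borelType R (im_charge mu)
  (im_charge0 mu) (fun _ _ => erefl) (@im_charge_sigma_additive mu).

(* The integral against a charge does not depend on the Hahn decomposition. *)
Definition charge_integral (nu : {charge set borelType -> \bar R})
    (g : S -> R) : R :=
  let: exist P hP := cid (Hahn_decomposition nu) in
  let: exist N hPN := cid hP in
  \int[jordan_pos hPN]_x g x - \int[jordan_neg hPN]_x g x.

Definition cintegral mu (g : S -> C) : C :=
  let re_g x := complex.Re (g x) in let im_g x := complex.Im (g x) in
  (charge_integral (re_charge mu) re_g - charge_integral (im_charge mu) im_g)
  +i* (charge_integral (re_charge mu) im_g +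
       charge_integral (im_charge mu) re_g).

Definition vanishing_at_infinity : set (S -> C) := [set g | continuous g /\
  forall e : R, 0 < e -> compact [set x | e%:C <= `|g x|]].

End integral.

Section measure_algebra.
Variables (R : realType) (S : ptopologicalType).
Local Notation C := (Cplx R).
Local Notation M := (regular_measure R S).
Implicit Types (mu nu : M) (f : topdual M) (X : set (topdual M)).

Definition semitopological_semigroup (mul : S -> S -> S) :=
  [/\ associative mul, forall x, continuous (mul x) &
      forall y, continuous (mul ^~ y)].

(* By the Riesz representation theorem the first axiom determines the product;
   the others say that M(S) is a Banach algebra for it. *)
Record convolution_algebra (mul : S -> S -> S) := ConvolutionAlgebra {
  convolution :> M -> M -> M;
  conv_integral : forall mu nu g, vanishing_at_infinity g ->
    cintegral (convolution mu nu) g =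
    cintegral nu (fun y => cintegral mu (fun x => g (mul x y)));
  conv_linearl : forall nu (a : C) mu1 mu2,
    convolution (a *: mu1 + mu2) nu = a *: convolution mu1 nu + convolution mu2 nu;
  conv_linearr : forall mu (a : C) nu1 nu2,
    convolution mu (a *: nu1 + nu2) = a *: convolution mu nu1 + convolution mu nu2;
  convA : associative convolution;
  conv_norm : forall mu nu, `|convolution mu nu| <= `|mu| * `|nu| }.

Lemma measure_normE mu : `|mu| = measure_norm mu. Proof. by []. Qed.

Fact total_mass_subproof : (fun mu => mu setT : C) \in @dual_pred R M.
Proof.
apply/asboolP; split=> //; exists 1 => mu; rewrite mul1r measure_normE.
rewrite normCE lerC -lee_fin fineK ?tv_fin//.
exact: normc_le_tv.
Qed.

Definition total_mass : topdual M := Dual total_mass_subproof.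

Fact conj_dual_subproof f :
  (fun mu => (f (conj_measure mu))^* : C) \in @dual_pred R M.
Proof.
have /asboolP[lf [k bf]] := dualP f; apply/asboolP; split.
  move=> a mu nu.
  rewrite (_ : conj_measure _ = a^* *: conj_measure mu + conj_measure nu).
    by rewrite lf rmorphD rmorphM /= conjcK.
  apply/val_inj/funext => A.
  by rewrite -[RHS]/(a^* * (mu A)^* + (nu A)^*) -rmorphM -rmorphD.
exists k => mu; rewrite normCE normc_conj -normCE.
rewrite (_ : `|mu| = `|conj_measure mu|); first exact: bf.
rewrite !measure_normE /measure_norm; congr (fine _)%:C.
by apply: tv_le => B /=; rewrite normc_conj.
Qed.

Definition conj_dual f : topdual M := Dual (conj_dual_subproof f).

Definition nonneg_functional f := forall mu, positive_measure mu -> 0 <= f mu.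

Definition linear_subspace X :=
  X 0 /\ forall (a : C) f g, X f -> X g -> X (a *: f + g).

(* On a complex subspace that is not self-adjoint, a functional that is
   nonnegative on the nonnegative elements need not extend to a mean: take
   S = Z/3, h = (1, i, 0) and m (a + b h) = a + 100 b on X = span(1, h). *)
Definition self_adjoint X := forall f, X f -> X (conj_dual f).

(* An element of the dual of X is given by its values on X; the values of m
   off X are irrelevant. *)
Definition bounded_linear_on X (m : topdual M -> C) :=
  (forall (a : C) f g, X f -> X g -> m (a *: f + g) = a * m f + m g) /\
  exists k : R, forall f, X f -> `|m f| <= k%:C * `|f|.

Definition mean_on X (m : topdual M -> C) :=
  [/\ bounded_linear_on X m,
      forall f, X f -> nonneg_functional f -> 0 <= m f &
      m total_mass = 1].

Section action.
Variables (mul : S -> S -> S) (A : convolution_algebra mul).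

Fact translate_subproof f mu : (fun la => f (A mu la) : C) \in @dual_pred R M.
Proof.
have /asboolP[lf [k bf]] := dualP f; apply/asboolP; split.
  by move=> a x y; rewrite conv_linearr lf.
exists (`|k| * fine (total_variation mu setT)) => la.
rewrite rmorphM -mulrA; apply: le_trans (bf _) _.
apply: (@le_trans _ _ (`|k|%:C * `|A mu la|)).
  by rewrite ler_wpM2r// lerC ler_norm.
rewrite ler_wpM2l//; last exact: conv_norm.
by rewrite -[0]/(0%:C) lerC.
Qed.

(* The functional f mu : la |-> <f, mu * la>. *)
Definition translate f mu : topdual M := Dual (translate_subproof f mu).

Definition topologically_left_invariant (m : topdual M -> C) :=
  forall mu f, probability_measures mu -> m (translate f mu) = m f.

Record right_action (T : M -> topdual M -> topdual M) : Prop := RightAction {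
  action_linearl : forall f (a : C) mu nu,
    T (a *: mu + nu) f = a *: T mu f + T nu f;
  action_linearr : forall mu (a : C) f g,
    T mu (a *: f + g) = a *: T mu f + T mu g;
  action_conv : forall mu nu f, T (A mu nu) f = T nu (T mu f);
  action_nonneg : forall mu f, probability_measures mu ->
    nonneg_functional f -> nonneg_functional (T mu f);
  action_one : forall mu, probability_measures mu ->
    T mu total_mass = total_mass }.

End action.

(* M(S) carries sigma(M(S), M(S)^* ) and M(S)^* carries
   sigma(M(S)^*, M(S)^** ). *)
Definition weakly_separately_continuous (T : M -> topdual M -> topdual M) :=
  (forall f, continuous
     ((fun mu => T mu f) : weak_topology M -> weak_topology (topdual M))) /\
  (forall mu, continuous
     (T mu : weak_topology (topdual M) -> weak_topology (topdual M))).

Definition invariant_subset (T : M -> topdual M -> topdual M) X :=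
  forall mu f, probability_measures mu -> X f -> X (T mu f).

Definition invariant_mean_on (T : M -> topdual M -> topdual M) X (m : topdual M -> C) :=
  mean_on X m /\
  forall mu f, probability_measures mu -> X f -> m (T mu f) = m f.

End measure_algebra.

(* Main.v *)
(* From a topologically left invariant mean M0 to extensions: by Hahn-Banach,
   with the sublinear majorant sup {Re f(mu) : mu a probability}, the given mean
   extends to a mean n on M(S)^*.  Weak continuity of the action makes
   phi_f : mu |-> n(T_mu f) an element of M(S)^*, phi_(T_nu f) = phi_f nu, and
   f |-> M0(phi_f) is the invariant extension; it agrees with the given mean on X
   because there phi_f is constant on probabilities, and these span M(S).

   Conversely, apply the extension property to T_mu f = f mu and X = C.1.  The
   only issue is that convolution preserves probabilities.  As |mu * nu| <= 1,
   it suffices that (mu * nu)(S) = 1: a measure whose norm and mass are both 1 is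
   positive.  The mass is computed with functions h in C_0 through
   int h d(mu * nu) = int int h(xy) dmu(x) dnu(y), and it does not escape to
   infinity because the translates of mu by points y near y0 are uniformly tight.
   Multiplication being only separately continuous, this uniform tightness rests
   on the Eberlein-Grothendieck sequential argument. *)
Require Import Defs.
From mathcomp Require Import all_boot all_order all_algebra.
From mathcomp Require Import all_classical all_reals all_analysis.
From mathcomp.real_closed Require Import complex.
From mathcomp Require Import measurable_realfun ring lra.
Import Order.TTheory GRing.Theory Num.Theory.
Import numFieldNormedType.Exports ComplexField.Normc.
Local Open Scope classical_set_scope.
Local Open Scope ring_scope.
Local Open Scope complex_scope.
Set Implicit Arguments.
Unset Strict Implicit.
Unset Printing Implicit Defensive.

(** * Separately continuous functions *)

Section topology.

Lemma filter_all_seq {I : eqType} {T : Type} (F : set_system T) {FF : Filter F}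
    (s : seq I) (P : I -> T -> Prop) :
  (forall i, i \in s -> \forall x \near F, P i x) ->
  \forall x \near F, forall i, i \in s -> P i x.
Proof.
elim: s => [|i s IH] h; first by apply: nearW => x i; rewrite in_nil.
have hi := h i (mem_head _ _).
have {}IH : \forall x \near F, forall j, j \in s -> P j x.
  by apply: IH => j js; apply: h; rewrite in_cons js orbT.
by apply: filterS2 hi IH => x hi IH j; rewrite in_cons => /predU1P[->//|/IH].
Qed.

(** Continuity of [g] at [z] puts values [g (u i)] with [i] in any prescribed set of [F] near [g z],
    and these values are eventually near [c]. Distinct [g z] and [c] would be separated by half
    their distance. *)
Lemma cluster_comp_cvg {R : realType} {I : Type} {Y : topologicalType}
    (F : set_system I) {FF : Filter F} (u : I -> Y) (z : Y) (g : Y -> R) (c : R) :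
  cluster (u @ F) z -> {for z, continuous g} -> g (u i) @[i --> F] --> c ->
  g z = c.
Proof.
move=> uz gz /cvgrPdist_lt gc; apply/eqP; rewrite -subr_eq0 -normr_eq0.
apply/negPn/negP => d0; have e0 : 0 < `|g z - c| / 2.
  by rewrite divr_gt0// lt_neqAle eq_sym d0 normr_ge0.
have [_ [[i /= gi <-]]] : (u @` [set i | `|c - g (u i)| < `|g z - c| / 2]) `&`
    [set y | `|g z - g y| < `|g z - c| / 2] !=set0.
  apply: uz; last by move/cvgrPdist_lt : gz; apply.
  by move: (gc _ e0); apply: filterS => i hi; exists i.
have := ler_distD (g (u i)) (g z) c.
rewrite (distrC (g (u i)) c) => h1 h2.
have := le_lt_trans h1 (ltrD h2 gi); rewrite -splitr ltxx//.
Qed.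

Lemma compact_cluster_cvg {R : realType} {Y : topologicalType} (L : set Y)
    (u : nat -> Y) (g : Y -> R) (c : R) :
  compact L -> (forall n, L (u n)) -> continuous g ->
  (forall z, L z -> cluster (u @ \oo) z -> g z = c) -> g (u n) @[n --> \oo] --> c.
Proof.
move=> cL Lu gC gc; apply/cvgrPdist_lt => e e0; apply: contrapT => nE.
pose E := [set n | e <= `|c - g (u n)|].
(* If [g (u n)] did not converge to [c], [E] would be met infinitely often for some [e]. Compactness
   then yields a cluster point of [u] along [E], where [g] is at distance at least [e] from [c] up
   to a vanishing error. *)
have EF : ProperFilter (within E \oo).
  split=> [n0|]; last exact: (within_filter E eventually_filter).
  apply: nE; apply: (@filterS _ \oo _ _ _ _ n0) => n hn.
  by rewrite ltNge; apply/negP => /hn.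
have [|z [Lz uz]] := cL (u @ within E \oo) _.
  by rewrite /nbhs/= /within/=; apply: nearW.
have gz : g z = c.
  apply: gc => // A B uA; apply: uz; apply: cvg_within; exact: uA.
have [_ [[n En <-]]] : (u @` E) `&` [set y | `|g z - g y| < e] !=set0.
  apply: uz; first by rewrite /nbhs/= /within/=; apply: nearW => n En; exists n.
  by have /cvgrPdist_lt := gC z; apply.
by rewrite /= gz ltNge En.
Qed.

Lemma compact_finite_subcover {X : ptopologicalType} (K : set X)
    (U : X -> set X) : compact K -> (forall x, K x -> nbhs x (U x)) ->
  exists D : seq X, (forall d, d \in D -> K d) /\
    forall x, K x -> exists2 d, d \in D & U d x.
Proof.
rewrite compact_cover => cK KU.
have [|x Kx|D DK KD] := cK _ K (fun x => (U x)°).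
- by move=> x _; exact: open_interior.
- by exists x => //; exact: KU.
exists (finmap.enum_fset D); split=> [d dD|x /KD[d dD /interior_subset Ud]].
  by apply/set_mem; exact: DK.
by exists d.
Qed.

Lemma compact_finite_net {R : realType} {X : ptopologicalType} (K : set X)
    {I : eqType} (s : seq I) (h : I -> X -> R) (e : R) :
  compact K -> (forall i, continuous (h i)) -> 0 < e ->
  exists D : seq X, (forall d, d \in D -> K d) /\
    forall x, K x -> exists2 d, d \in D & forall i, i \in s -> `|h i x - h i d| < e.
Proof.
move=> cK hC e0.
have [x Kx|D [DK KD]] := compact_finite_subcover cK
    (U := fun x => [set y | forall i, i \in s -> `|h i x - h i y| < e]) _.
  apply: filter_all_seq => i _; by have /cvgrPdist_lt := hC i x; apply.
exists D; split=> // x /KD[d dD hd]; exists d => // i /hd; by rewrite distrC.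
Qed.

End topology.

Section separately_continuous.
Context {R : realType} {X : ptopologicalType} {Y : topologicalType} (f : X -> Y -> R).
Hypotheses (f_contl : forall y, continuous (f ^~ y))
           (f_contr : forall x, continuous (f x)).
Context (K : set X) (L B : set Y) (y0 : Y).
Hypotheses (cK : compact K) (cL : compact L) (Ly0 : nbhs y0 L).
Hypothesis By0 : closure B y0.

(* Choose alternately y_n in B close to y0 on a finite subset D_n of K, and D_n.+1
   so large that K is n.+1^-1-approximated by D_n.+1 for f(., y0), ..., f(., y_n).
   Any cluster point z of (y_n) then satisfies f(., z) = f(., y0) on K. *)
Lemma separately_continuous_seq : exists y : nat -> Y,
  (forall n, B (y n)) /\
  forall x, K x -> f x (y n) @[n --> \oo] --> f x y0.
Proof.
have e_gt0 n : 0 < n.+1%:R^-1 :> R by [].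
have netE (s : seq Y) n : exists D : seq X, (forall d, d \in D -> K d) /\
    forall x, K x -> exists2 d, d \in D &
      forall y, y \in s -> `|f x y - f d y| < n.+1%:R^-1.
  exact: (@compact_finite_net _ _ _ _ s (fun y => f ^~ y)).
pose net s n := sval (cid (netE s n)).
have netP s n := svalP (cid (netE s n)).
have nextE (D : seq X) n : exists y, [/\ B y, L y &
    forall d, d \in D -> `|f d y0 - f d y| < n.+1%:R^-1].
  have [|y [By [Ly fy]]] := By0 (B := L `&`
      [set y | forall d, d \in D -> `|f d y0 - f d y| < n.+1%:R^-1]).
    apply: filterI => //; apply: filter_all_seq => d _.
    by have /cvgrPdist_lt := @f_contr d y0; apply.
  by exists y.
pose next D n := sval (cid (nextE D n)).
have nextP D n := svalP (cid (nextE D n)).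
(* [(st n).1] lists the terms of the sequence before index [n], followed by the limit point [y0];
   [(st n).2] is the finite set D_n. Keeping [y0] in the list makes the nets respect f(., y0) as
   well. *)
pose fix st (n : nat) : seq Y * seq X := if n is m.+1 then
  let ys := next (st m).2 m :: (st m).1 in (ys, (st m).2 ++ net ys m)
  else ([:: y0], [::]).
pose y n := next (st n).2 n.
have By n : B (y n) by have [] := nextP (st n).2 n.
have Lyn n : L (y n) by have [] := nextP (st n).2 n.
have y0_in n : y0 \in (st n).1.
  by elim: n => [|n IH]; [exact: mem_head|rewrite /= in_cons IH orbT].
have y_in m n : (m < n)%N -> y m \in (st n).1.
  elim: n => // n IH; rewrite ltnS leq_eqVlt => /predU1P[->|/IH h].
    exact: mem_head.
  by rewrite /= in_cons h orbT.
have D_mono m n d : (m <= n)%N -> d \in (st m).2 -> d \in (st n).2.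
  move=> + dm; elim: n => [|n IH]; first by rewrite leqn0 => /eqP mE; rewrite -mE.
  rewrite leq_eqVlt => /predU1P[<-//|/IH h].
  by rewrite /= mem_cat h.
have cvgD n d : d \in (st n).2 -> f d (y m) @[m --> \oo] --> f d y0.
  move=> dn; apply/cvgrPdist_lt => e e0.
  near=> m; have [_ _ /(_ d)] := nextP (st m).2 m; rewrite -/(y m) => h.
  apply: lt_trans (h _) _.
    by apply: D_mono dn; near: m; exact: nbhs_infty_ge.
  by near: m; exact: near_infty_natSinv_lt (PosNum e0).
(* A double limit: pick d_n in D_n.+1 that imitates [x] on all terms listed so far, and a cluster
   point [a] of (d_n) in [K]. Then f(a, .) = f(x, .) at every y_m and at [y0], hence at [z]. Since
   f(d_n, z) = f(d_n, y0) for all n, also f(a, z) = f(a, y0). *)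
have cluster_eq z x : cluster (y @ \oo) z -> K x -> f x z = f x y0.
  move=> yz Kx.
  pose ys n := next (st n).2 n :: (st n).1.
  have dP n : exists d, [/\ d \in (st n.+1).2, K d &
      forall v, v \in (st n.+1).1 -> `|f x v - f d v| < n.+1%:R^-1].
    have [Dk /(_ x Kx)[d dD fd]] := netP (ys n) n.
    exists d; split => //; last exact: Dk.
    by rewrite /= mem_cat dD orbT.
  pose d n := sval (cid (dP n)).
  have dP' n := svalP (cid (dP n)).
  have dK : \forall n \near \oo, K (d n) by apply: nearW => n; have [] := dP' n.
  have [a [Ka da]] := @cK (d @ \oo) _ dK.
  have fa v n0 : (forall n, (n0 <= n)%N -> v \in (st n.+1).1) -> f a v = f x v.
    move=> hv; apply: (cluster_comp_cvg (g := f ^~ v) da); first exact: f_contl.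
    apply/cvgrPdist_lt => e e0; near=> n.
    have [_ _ /(_ v) h] := dP' n; apply: lt_trans (h _) _.
      by apply: hv; near: n; exact: nbhs_infty_ge.
    by near: n; exact: near_infty_natSinv_lt (PosNum e0).
  have faz : f a z - f x z = 0.
    apply: (cluster_comp_cvg (g := fun v => f a v - f x v) yz).
      by apply: cvgB; exact: f_contr.
    rewrite (_ : (fun _ => _) = fun=> 0); first exact: cvg_cst.
    apply/funext => m; apply/eqP; rewrite subr_eq0; apply/eqP.
    by apply: (fa _ m) => n mn; exact: y_in.
  have faz0 : f a z - f a y0 = 0.
    apply: (cluster_comp_cvg (g := fun v => f v z - f v y0) da).
      by apply: cvgB; exact: f_contl.
    rewrite (_ : (fun _ => _) = fun=> 0); first exact: cvg_cst.
    apply/funext => m; apply/eqP; rewrite subr_eq0; apply/eqP.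
    have [dm _ _] := dP' m.
    by apply: (cluster_comp_cvg yz); [exact: f_contr|exact: cvgD dm].
  have := fa y0 0%N (fun n _ => y0_in _).
  lra.
exists y; split => // x Kx.
by apply: (compact_cluster_cvg cL) => // z Lz yz; exact: cluster_eq.
Unshelve. all: by end_near. Qed.

End separately_continuous.

(** * Urysohn functions on a locally compact Hausdorff space *)

Section urysohn_compact.
Context {R : realType} {X : topologicalType}.
Hypotheses (lcX : locally_compact [set: X]) (hX : hausdorff_space X).

(** The one-point compactification is compact Hausdorff, hence normal, and [K] and the point at
    infinity are disjoint closed sets in it. A continuous function that separates them vanishes at
    infinity, so its superlevel sets at positive heights are compact. *)
Lemma urysohn_compact (K : set X) : compact K ->
  exists h : X -> R, [/\ continuous h, forall x, 0 <= h x <= 1,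
    forall x, K x -> h x = 1 &
    forall e : R, 0 < e -> compact [set x | e <= h x]].
Proof.
move=> cK; pose X' := one_point_compactification X.
have hX' : hausdorff_space X' by exact: one_point_compactification_hausdorff.
have nX' : normal_space X'.
  by apply: compact_normal => //; exact: one_point_compactification_compact.
have cSK : closed (Some @` K : set X').
  apply: compact_closed => //; apply: continuous_compact => //.
  apply: continuous_subspaceT; exact: one_point_compactification_some_continuous.
have cN : closed [set (None : X')].
  by apply: accessible_closed_set1; exact: hausdorff_accessible.
have NK : [set (None : X')] `&` Some @` K = set0.
  by rewrite -subset0 => _ [->] [].
have /normal_separatorP/(_ _ _ cN cSK NK)/(uniform_separatorP (R := R)) := nX'.
move=> /(_ R)[f [fC f01 f0 f1]].
have hC : continuous (f \o Some).
  by move=> x; apply: continuous_comp; [|exact: fC].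
exists (f \o Some); split=> //.
- by move=> x; have := f01 (f (Some x)) (imageT _ _); rewrite /= in_itv.
- by move=> x Kx; apply: f1; exists (Some x) => //; exists x.
- move=> e e0.
  have fN : f None = 0 by apply: f0; exists None.
  have : nbhs (None : X') [set y | `|f None - f y| < e].
    by have /cvgrPdist_lt := fC None; apply.
  (* A neighborhood of infinity contains the complement of a closed compact [C]; the superlevel set
     is a closed subset of [C]. *)
  move=> [C [cC clC] CE].
  apply: (subclosed_compact _ cC).
    rewrite (_ : mkset _ = (f \o Some) @^-1` [set r | e <= r])//.
    by apply: closed_comp; [move=> x _; exact: hC|exact: closed_ge].
  move=> x /= ex; apply: contrapT => nCx.
  have /= := CE (Some x) (or_introl (ex_intro2 _ _ x nCx erefl)).
  rewrite fN sub0r normrN ltNge; apply/negP; rewrite negbK.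
  by apply: le_trans ex _; exact: ler_norm.
Qed.

End urysohn_compact.

(** * Hahn-Banach *)

Section hahn_banach.
Context {R : realType} {V : lmodType R[i]} (p : V -> R).
Hypothesis p_subadditive : forall x y, p (x + y) <= p x + p y.
Hypothesis p_homogeneous : forall (r : R) x, 0 < r -> p (r%:C *: x) = r * p x.

(* Graphs of partial real-linear functionals below p; functionality of the graph
   follows from the bound. *)
Definition dominated_graph (G : set (V * R)) :=
  (forall u v (t : R), G u -> G v -> G (t%:C *: u.1 + v.1, t * u.2 + v.2)) /\
  forall u, G u -> u.2 <= p u.1.

(** The one-dimensional step. The value [c] at [v] must lie above every u.2 - p(u.1 - v) and below
    every p(w.1 + v) - w.2; subadditivity makes these bounds compatible, and [sup E] is such a
    value. Homogeneity reduces an arbitrary multiple of [v] to [v] or [- v]. *)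
Lemma dominated_graph_extend (G : set (V * R)) v : dominated_graph G ->
  G (0, 0) -> exists c, dominated_graph
    [set w | exists u t, G u /\ w = (u.1 + t%:C *: v, u.2 + t * c)].
Proof.
move=> [linG leG] G0; pose E := [set u.2 - p (u.1 - v) | u in G].
have ubE u w : G u -> G w -> u.2 - p (u.1 - v) <= p (w.1 + v) - w.2.
  move=> Gu Gw; have /leG /= := linG _ _ 1 Gu Gw.
  rewrite scale1r mul1r -[X in p X](_ : (u.1 - v) + (w.1 + v) = _).
    by move=> h; have := le_trans h (p_subadditive _ _); lra.
  by rewrite addrACA addNr addr0.
have supE : has_sup E.
  split; first by exists (0 - p (0 - v)), (0, 0).
  by exists (p (0 + v) - 0) => _ [u Gu <-]; exact: (ubE _ (0, 0)).
exists (sup E); split.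
  move=> _ _ t [u [s [Gu ->]]] [u' [s' [Gu' ->]]] /=.
  exists (t%:C *: u.1 + u'.1, t * u.2 + u'.2), (t * s + s'); split=> /=.
    exact: linG.
  congr pair; last by ring.
  by rewrite rmorphD rmorphM scalerDr scalerDl scalerA addrACA.
have scaleG u (t : R) : G u -> G (t%:C *: u.1, t * u.2).
  by move=> Gu; have := linG _ _ t Gu G0; rewrite !addr0.
move=> _ [u [t [Gu ->]]] /=.
have [t0|t0|->] := ltrgtP t 0; last 1 first.
- by rewrite scale0r mul0r !addr0; exact: leG.
- have s0 : 0 < - t by rewrite oppr_gt0.
  have : (- t)^-1 * u.2 - p ((- t)^-1%:C *: u.1 - v) <= sup E.
    by apply: ub_le_sup; [case: supE|exists ((- t)^-1%:C *: u.1, (- t)^-1 * u.2);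
      [exact: scaleG|]].
  rewrite -(ler_pM2l s0) mulrBr mulrA divff ?gt_eqF// mul1r.
  rewrite -p_homogeneous// scalerBr scalerA -rmorphM divff ?gt_eqF//.
  rewrite scale1r rmorphN scaleNr opprK mulNr; lra.
- have : sup E <= p (t^-1%:C *: u.1 + v) - t^-1 * u.2.
    apply: ge_sup; first by case: supE.
    by move=> _ [w Gw <-]; apply: (ubE w (_, _)) => //; exact: scaleG.
  rewrite -(ler_pM2l t0) mulrBr mulrA divff ?gt_eqF// mul1r.
  rewrite -p_homogeneous// scalerDr scalerA -rmorphM divff ?gt_eqF//.
  by rewrite scale1r; lra.
Qed.

Lemma hahn_banach_real (G0 : set (V * R)) : dominated_graph G0 -> G0 (0, 0) ->
  exists g : V -> R,
    [/\ forall (t : R) x y, g (t%:C *: x + y) = t * g x + g y,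
        forall x, g x <= p x & forall u, G0 u -> g u.1 = u.2].
Proof.
move=> domG0 G00.
(* Zorn's lemma is applied to the sets [G] for which the union with [G0] is dominated, so that the
   empty union, which need not contain [G0], qualifies. *)
have [|G [[linG leG] maxG]] := @Zorn_bigcup _
    [set G | dominated_graph (G0 `|` G)].
  move=> F domF totF; split.
    move=> u v t [G0u|[A FA Au]] [G0v|[B FB Bv]].
    - by left; apply: domG0.1.
    - have [h|h] := (domF _ FB).1 u v t (or_introl G0u) (or_intror Bv).
        by left.
      by right; exists B.
    - have [h|h] := (domF _ FA).1 u v t (or_intror Au) (or_introl G0v).
        by left.
      by right; exists A.
    - have [C [FC Cu Cv]] : exists C, [/\ F C, C u & C v].
        have [AB|BA] := totF _ _ FA FB; first by exists B; split=> //; exact: AB.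
        by exists A; split=> //; exact: BA.
      have [h|h] := (domF _ FC).1 u v t (or_intror Cu) (or_intror Cv).
        by left.
      by right; exists C.
  move=> u [/domG0.2//|[A FA Au]].
  by apply: (domF _ FA).2; right.
set H := G0 `|` G in linG leG.
have H0 : H (0, 0) by left.
have scaleH u (t : R) : H u -> H (t%:C *: u.1, t * u.2).
  by move=> Hu; have := linG _ _ t Hu H0; rewrite !addr0.
have p0 : p 0 = 0.
  have := @p_homogeneous 2 0; rewrite scaler0 => /(_ (ltr0n _ 2)); lra.
have funH x r s : H (x, r) -> H (x, s) -> r = s.
  move=> Hr Hs; apply/eqP; rewrite eq_le; apply/andP; split.
    have /leG /= := linG _ _ (-1) Hs Hr.
    by rewrite rmorphN scaleNr scale1r addNr p0; lra.
  have /leG /= := linG _ _ (-1) Hr Hs.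
  by rewrite rmorphN scaleNr scale1r addNr p0; lra.
have totH x : exists r, H (x, r).
  apply: contrapT => nH.
  have [c domH'] := @dominated_graph_extend _ x (conj linG leG) H0.
  set H' := (X in dominated_graph X) in domH'.
  have HH' : H `<=` H'.
    by move=> u Hu; exists u, 0; rewrite scale0r mul0r !addr0 -surjective_pairing.
  apply: (maxG H').
    split=> [u Gu|]; first by apply: HH'; right.
    move=> /(_ (x, c)) h; apply: nH; exists c; right; apply: h.
    by exists (0, 0), 1; rewrite scale1r mul1r !add0r.
  by rewrite /= (_ : G0 `|` H' = H') //; apply: setUidr => u ?; apply: HH'; left.
pose g x := sval (cid (totH x)).
have gP x : H (x, g x) by rewrite /g; case: cid.
exists g; split.
- by move=> t x y; apply: (@funH (t%:C *: x + y)); [|exact: (linG (_, _) (_, _))].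
- by move=> x; exact: (leG (_, _)).
- by move=> [x r] G0u; apply: (@funH x) => //; left.
Qed.

Local Notation C := (Cplx R).

(** The real part of [m] is extended to a real-linear [g]; then x |-> g(x) - i g(ix) is the
    complex-linear functional with real part [g]. *)
Lemma hahn_banach_complex (X : set V) (m : V -> C) :
  X 0 -> (forall (a : C) x y, X x -> X y -> X (a *: x + y)) ->
  (forall (a : C) x y, X x -> X y -> m (a *: x + y) = a * m x + m y) ->
  (forall x, X x -> complex.Re (m x) <= p x) ->
  exists m' : V -> C,
    [/\ forall (a : C) x y, m' (a *: x + y) = a * m' x + m' y,
        forall x, complex.Re (m' x) <= p x & forall x, X x -> m' x = m x].
Proof.
move=> X0 linX linm lem.
have m0 : m 0 = 0.
  have := linm 1 0 0 X0 X0; rewrite scale1r addr0 mul1r => h.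
  by apply: (addrI (m 0)); rewrite -h addr0.
have [||g [ling leg gm]] := @hahn_banach_real
    [set u | X u.1 /\ u.2 = complex.Re (m u.1)].
- split; last by move=> [x r] /= [Xx ->]; exact: lem.
  move=> [x r] [y s] t /= [Xx ->] [Xy ->]; split; first exact: linX.
  by rewrite linm// raddfD /=; case: (m x) => a b; rewrite /= mul0r subr0.
- by rewrite /= m0.
have gD x y : g (x + y) = g x + g y.
  by have := ling 1 x y; rewrite scale1r mul1r.
have g0 : g 0 = 0 by have := gD 0 0; rewrite addr0; lra.
have gZ (t : R) x : g (t%:C *: x) = t * g x.
  by have := ling t x 0; rewrite !addr0 g0 addr0.
exists (fun x => (g x -i* g ('i%C *: x)) : C); split.
- move=> [a b] x y.
  have -> : 'i%C *: ((a +i* b) *: x + y) =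
      a%:C *: ('i%C *: x) + ((- b)%:C *: x + 'i%C *: y).
    rewrite scalerDr !scalerA addrA -scalerDl; congr (_ *: _ + _).
    by simpc.
  have -> : (a +i* b) *: x + y = a%:C *: x + (b%:C *: ('i%C *: x) + y).
    rewrite !scalerA addrA -scalerDl; congr (_ *: _ + _).
    by simpc.
  rewrite !gD !gZ; apply/eqP; rewrite eq_complex /=; apply/andP.
  by split; apply/eqP; ring.
- by move=> x; exact: leg.
- move=> x Xx.
  have Xix : X ('i%C *: x) by rewrite -[_ *: _]addr0; exact: linX.
  rewrite (gm (_, complex.Re (m x)))// (gm (_, complex.Re (m ('i%C *: x))))//=.
  rewrite -[_ *: _]addr0 linm// m0 addr0.
  by case: (m x) => a b; rewrite /= mul0r mul1r sub0r opprK.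
Qed.

End hahn_banach.

(** * Regular measures *)

(* Measurability is not required: the integral of a nonnegative function is
   defined as a supremum over the simple functions below it. *)
Lemma ge0_le_integralT {d} {T : measurableType d} {R : realType}
    (mu : {measure set T -> \bar R}) (f1 f2 : T -> \bar R) :
  (forall x, 0 <= f1 x)%E -> (forall x, f1 x <= f2 x)%E ->
  (\int[mu]_x f1 x <= \int[mu]_x f2 x)%E.
Proof.
move=> f0 f12; have f20 x : (0 <= f2 x)%E by exact: le_trans (f12 x).
rewrite !ge0_integralTE//; apply: le_ereal_sup => _ [h hf1 <-].
by exists h => // x; exact: le_trans (hf1 x) (f12 x).
Qed.

Section regular_measure_facts.
Context {R : realType} {S : ptopologicalType}.
Local Notation C := (Cplx R).
Local Notation borel := ((@open S).-sigma.-measurable).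
Local Notation borelType := (g_sigma_algebraType (@open S)).
Implicit Types (mu nu : regular_measure R S) (A B P : set S).

Lemma regular_measure_nonborel mu A : ~ borel A -> mu A = 0.
Proof. by have [n0 _ _ _] := regular_measure_prop mu; exact: n0. Qed.

Lemma regular_measure_ext mu nu :
  (forall A, borel A -> mu A = nu A) -> mu = nu.
Proof.
move=> h; apply/val_inj/funext => A; have [|nA] := pselect (borel A); first exact: h.
by rewrite [LHS](regular_measure_nonborel mu nA) [RHS](regular_measure_nonborel nu nA).
Qed.

Lemma borel_positive_measure mu :
  (forall A, borel A -> 0 <= mu A) -> positive_measure mu.
Proof.
move=> mu0 A; have [|nA] := pselect (borel A); first exact: mu0.
by rewrite (regular_measure_nonborel mu nA).
Qed.

Lemma regular_measureU mu A B : borel A -> borel B -> A `&` B = set0 ->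
  mu (A `|` B) = mu A + mu B.
Proof.
move=> mA mB AB0; apply/eqP; rewrite eq_complex !raddfD/=; apply/andP; split.
  have := @chargeU _ borelType R (re_charge mu) _ _ mA mB AB0.
  by rewrite /re_charge -EFinD => -[->].
have := @chargeU _ borelType R (im_charge mu) _ _ mA mB AB0.
by rewrite /im_charge -EFinD => -[->].
Qed.

Lemma regular_measure_setIC mu A P : borel A -> borel P ->
  mu A = mu (A `&` P) + mu (A `&` ~` P).
Proof.
move=> mA mP; rewrite -[in LHS](setIT A) -(setUv P) setIUr regular_measureU//.
- exact: (@measurableI _ borelType).
- by apply: (@measurableI _ borelType) => //; exact: (@measurableC _ borelType).
- by rewrite setIACA setICr setI0.
Qed.

Lemma borel_setT : borel setT.
Proof. exact: (@measurableT _ borelType). Qed.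

(** The case split is forced by the convention on non-Borel sets: such a set may have a Borel trace
    on [P]. *)
Fact restrict_subproof mu P : borel P ->
  (fun A => if `[< borel A >] then mu (A `&` P) else 0 : C)
    \in @regular_measure_pred R S.
Proof.
move=> mP; set muP := (X in X \in _).
have mI A : borel A -> borel (A `&` P).
  by move=> mA; exact: (@measurableI _ borelType).
have muPE A : borel A -> muP A = mu (A `&` P) by move=> mA; rewrite /muP asboolT.
have [n0 s b r] := regular_measure_prop mu.
have tvP A : (Defs.total_variation muP A <= Defs.total_variation mu A)%E.
  apply: ge_ereal_sup => _ [n [F [mF FA tF ->]]].
  apply: ereal_sup_ubound; exists n, (fun i => F i `&` P); split=> //.
  - by move=> i; exact: mI.
  - by move=> i x [/FA].
  - exact: trivIset_setIr.
  - by congr EFin; apply: eq_bigr => i _; rewrite muPE.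
apply/asboolP; split.
- by move=> A nA; rewrite /muP asboolF.
- move=> F mF tF; have mUF : borel (\bigcup_i F i).
    exact: (@bigcupT_measurable _ borelType).
  rewrite muPE// setI_bigcupl.
  rewrite (_ : (fun n => _) = fun n => \sum_(i < n) mu (F i `&` P)).
    by apply: s => [i|]; [exact: mI|exact: trivIset_setIr].
  by apply/funext => n; apply: eq_bigr => i _; rewrite muPE.
- exact: le_lt_trans b.
- move=> A mA e e0; have [K [U [cK oU KA AU h]]] := r A mA e e0.
  by exists K, U; split=> //; exact: le_lt_trans h.
Qed.

Definition restrict_measure mu P (mP : borel P) : regular_measure R S :=
  RegularMeasure (restrict_subproof mu mP).

Lemma restrict_measureE mu P (mP : borel P) A :
  borel A -> restrict_measure mu mP A = mu (A `&` P).
Proof. by move=> mA; rewrite /= asboolT. Qed.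

Lemma positive_measure_mono mu A : positive_measure mu -> borel A ->
  mu A <= mu setT.
Proof.
move=> mu0 mA; rewrite (regular_measure_setIC mu borel_setT mA).
by rewrite setTI lerDl.
Qed.

Lemma positive_measure_eq0 mu : positive_measure mu -> mu setT = 0 -> mu = 0.
Proof.
move=> mu0 muT; apply: regular_measure_ext => A mA.
by apply: le_anti; rewrite mu0 andbT; have := positive_measure_mono mu0 mA; rewrite muT.
Qed.

Lemma positive_measure_normalize mu : positive_measure mu -> mu <> 0 ->
  probability_measures ((mu setT)^-1 *: mu).
Proof.
move=> mu0 nz; have nz' : mu setT != 0.
  by apply/eqP => /(positive_measure_eq0 mu0).
split; last by rewrite -[LHS]/((mu setT)^-1 * mu setT) mulVf.
by move=> A; rewrite -[_ A]/((mu setT)^-1 * mu A) mulr_ge0// invr_ge0.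
Qed.

Definition re_measure mu : regular_measure R S :=
  (2^-1 : C) *: (mu + conj_measure mu).

Lemma re_measureE mu A : re_measure mu A = (complex.Re (mu A))%:C.
Proof.
rewrite -[LHS]/(2^-1 * (mu A + (mu A)^*)); case: (mu A) => a b.
have -> : (a +i* b) + (a +i* b)^* = 2 * a%:C.
  by rewrite mulr_natl mulr2n; apply/eqP; rewrite eq_complex /= subrr addr0 !eqxx.
by rewrite mulrA mulVf ?mul1r// pnatr_eq0.
Qed.

(** Since Re(-iz) = Im z, the second term is i times the imaginary part of [mu]. *)
Lemma measure_re_im mu :
  mu = re_measure mu + ('i%C : C) *: re_measure (- ('i%C : C) *: mu).
Proof.
apply/val_inj/funext => A /=.
rewrite -[RHS]/(re_measure mu A + 'i%C * re_measure (- ('i%C : C) *: mu) A).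
rewrite !re_measureE.
have -> : (- ('i%C : C) *: mu) A = - 'i%C * mu A by [].
by case: (mu A) => a b; apply/eqP; rewrite eq_complex /=; apply/andP; split;
  apply/eqP; ring.
Qed.

(** * Probability measures span M(S) *)

Section span.
Variables f g : regular_measure R S -> C.
Hypothesis linf : forall (a : C) mu nu, f (a *: mu + nu) = a * f mu + f nu.
Hypothesis ling : forall (a : C) mu nu, g (a *: mu + nu) = a * g mu + g nu.
Hypothesis fg : forall mu, probability_measures mu -> f mu = g mu.

Let linear_eq0 : f 0 = g 0.
Proof.
have := linf 1 0 0; have := ling 1 0 0; rewrite scaler0 addr0 !mul1r => g0 f0.
have -> : f 0 = 0 by apply: (addrI (f 0)); rewrite -f0 addr0.
by apply: (addrI (g 0)); rewrite -g0 addr0.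
Qed.

Lemma linear_eq_positive mu : positive_measure mu -> f mu = g mu.
Proof.
move=> mu0; have [->|/eqP nz] := eqVneq mu 0; first exact: linear_eq0.
have nz' : mu setT != 0 by apply/eqP => /(positive_measure_eq0 mu0).
have -> : mu = mu setT *: ((mu setT)^-1 *: mu) + 0.
  by rewrite addr0 scalerA divff// scale1r.
by rewrite linf ling linear_eq0 fg//; exact: positive_measure_normalize.
Qed.

(** A Hahn decomposition of the real charge writes it as a difference of two positive measures,
    namely its restriction to [P] and minus its restriction to [N]. *)
Lemma linear_eq_re mu : f (re_measure mu) = g (re_measure mu).
Proof.
have [P [N [[mP posP] [mN negN] PN PN0]]] := Hahn_decomposition (re_charge mu).
have -> : re_measure mu =
    (-1 : C) *: (- restrict_measure (re_measure mu) mN) +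
    restrict_measure (re_measure mu) mP.
  rewrite scaleN1r opprK addrC; apply: regular_measure_ext => A mA.
  rewrite -[RHS]/(restrict_measure (re_measure mu) mP A +
    restrict_measure (re_measure mu) mN A).
  rewrite !restrict_measureE// -[in LHS](setIT A) -PN setIUr.
  rewrite regular_measureU//; [exact: (@measurableI _ borelType)|
    exact: (@measurableI _ borelType)|by rewrite setIACA PN0 setI0].
have posPr : positive_measure (restrict_measure (re_measure mu) mP).
  apply: borel_positive_measure => A mA.
  rewrite restrict_measureE// re_measureE lecR -lee_fin; apply: posP => //.
  exact: (@measurableI _ borelType).
have negNr : positive_measure (- restrict_measure (re_measure mu) mN).
  apply: borel_positive_measure => A mA.
  rewrite -[X in _ <= X]/(- restrict_measure (re_measure mu) mN A) oppr_ge0.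
  rewrite restrict_measureE// re_measureE lecR -lee_fin; apply: negN => //.
  exact: (@measurableI _ borelType).
by rewrite linf ling !linear_eq_positive.
Qed.

Lemma linear_eq_probability mu : f mu = g mu.
Proof. by rewrite (measure_re_im mu) addrC linf ling !linear_eq_re. Qed.

End span.

End regular_measure_facts.

(** * Integrals against finite measures *)

Section Rintegral_finite.
Context {d} {T : measurableType d} {R : realType}.
Variable m : {measure set T -> \bar R}.
Hypothesis m_fin : (m setT < +oo)%E.

(** The bound 1 and the finite mass keep both integrals finite, where [fine] is monotone; it would
    send an infinite integral to 0. *)
Lemma le_RintegralT (f1 f2 : T -> R) :
  (forall x, 0 <= f1 x) -> (forall x, f1 x <= f2 x) -> (forall x, f2 x <= 1) ->
  \int[m]_x f1 x <= \int[m]_x f2 x.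
Proof.
move=> f10 f12 f21; have f20 x : 0 <= f2 x by exact: le_trans (f12 x).
have fin (f : T -> R) : (forall x, 0 <= f x) -> (forall x, f x <= 1) ->
    (\int[m]_x (f x)%:E)%E \is a fin_num.
  move=> f0 fle1; rewrite ge0_fin_numE; last first.
    by apply: integral_ge0 => x _; rewrite lee_fin.
  apply: (@le_lt_trans _ _ (\int[m]_x (\1_setT x)%:E)%E).
    by apply: ge0_le_integralT => x; rewrite lee_fin// indicT.
  by rewrite integral_indic// setIT.
rewrite /Rintegral; apply: fine_le; [apply: fin => // x|exact: fin|].
  exact: le_trans (f12 x) _.
by apply: ge0_le_integralT => x; rewrite lee_fin.
Qed.

Lemma Rintegral_indicT (A : set T) : measurable A ->
  \int[m]_x \1_A x = fine (m A).
Proof. by move=> mA; rewrite /Rintegral integral_indic// setIT. Qed.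

End Rintegral_finite.

(** * Integrals against regular complex measures, norms and positivity *)

Section cintegral_facts.
Context {R : realType} {S : ptopologicalType}.
Local Notation C := (Cplx R).
Local Notation borel := ((@open S).-sigma.-measurable).
Local Notation borelType := (g_sigma_algebraType (@open S)).
Implicit Types (mu nu : regular_measure R S) (A B P : set S).

Lemma cintegral_real mu (g : S -> R) : cintegral mu (fun x => (g x)%:C) =
  charge_integral (re_charge mu) g +i* charge_integral (im_charge mu) g.
Proof.
have c0 (nu : {charge set borelType -> \bar R}) : charge_integral nu (fun=> 0) = 0.
  rewrite /charge_integral; case: cid => P hP; case: cid => N hPN.
  by rewrite !Rintegral_cst// !mul0r subr0.
by rewrite /cintegral /= !c0 subr0 add0r.
Qed.

(** This converts a lower bound on the integral of a test function into one on the mass, for a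
    measure not yet known to be positive. On the positive part h <= 1; on the negative part h
    dominates the indicator of [K]. The part of [N] outside [K] is all that is lost, and the
    variation off [K] controls it. *)
Lemma charge_integral_le_mass nu (h : S -> R) K : borel K ->
  (forall x, 0 <= h x <= 1) -> (forall x, K x -> h x = 1) ->
  charge_integral (re_charge nu) h <=
  complex.Re (nu setT) + fine (Defs.total_variation nu (~` K)).
Proof.
have arith (a b p k n t T : R) : a <= p -> - k <= b -> T = p + (k + n) ->
  - n <= t -> a - b <= T + t by clear; lra.
move=> mK h01 hK; rewrite /charge_integral.
case: cid => P hP; case: cid => N hPN.
have [[mP _] [mN _] PN PN0] := hPN.
have h0 x : 0 <= h x by have /andP[] := h01 x.
have h1 x : h x <= 1 by have /andP[] := h01 x.
have mT : measurable ([set: borelType]) by exact: measurableT.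
have jpE : \int[jordan_pos hPN]_x h x <= complex.Re (nu P).
  apply: (@le_trans _ _ (\int[jordan_pos hPN]_x \1_setT x)).
    apply: le_RintegralT => // [|x]; rewrite ?indicT//.
    by rewrite -ge0_fin_numE// fin_num_measure.
  rewrite Rintegral_indicT//= jordan_posE cjordan_posE /crestr0 mem_set//.
  by rewrite /crestr setTI.
have jnE : - complex.Re (nu (K `&` N)) <= \int[jordan_neg hPN]_x h x.
  apply: (@le_trans _ _ (\int[jordan_neg hPN]_x \1_K x)); last first.
    apply: le_RintegralT => // [|x].
      by rewrite -ge0_fin_numE// fin_num_measure.
    rewrite indicE; case: (boolP (x \in K)) => //.
    by rewrite inE => /hK ->.
  rewrite Rintegral_indicT//= jordan_negE cjordan_negE /crestr0 mem_set//.
have mNK : borel (N `&` ~` K).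
  by apply: (@measurableI _ borelType) => //; exact: (@measurableC _ borelType).
have nT : complex.Re (nu setT) = complex.Re (nu P) +
    (complex.Re (nu (K `&` N)) + complex.Re (nu (N `&` ~` K))).
  rewrite -PN regular_measureU// (regular_measure_setIC nu mN mK) !raddfD/=.
  by rewrite setIC.
apply: arith jpE jnE nT _.
apply: le_trans (_ : normc (nu (N `&` ~` K)) <= _).
  by apply: le_trans (normc_Re _); rewrite -normrN ler_norm.
rewrite -lee_fin fineK; first by apply: normc_le_tv => //; exact: subIsetr.
rewrite ge0_fin_numE ?tv_ge0//; apply: le_lt_trans (tv_subset _ _) _.
  exact: subsetT.
by have [] := regular_measure_prop nu.
Qed.

(** For positive [mu] the negative Hahn set of the real part is null and the imaginary part is zero.
    Three of the four Jordan integrals therefore vanish, and the remaining one is an ordinary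
    integral. *)
Lemma positive_measure_integral mu : positive_measure mu ->
  exists m : {measure set borelType -> \bar R},
    (forall A, m A = (complex.Re (mu A))%:E) /\
    forall g : S -> R, cintegral mu (fun x => (g x)%:C) = (\int[m]_x g x)%:C.
Proof.
move=> mu0.
have re0 A : (0 <= re_charge mu A)%E.
  by rewrite lee_fin; have := mu0 A; rewrite lecE => /andP[].
have im0 A : complex.Im (mu A) = 0.
  by have := mu0 A; rewrite lecE => /andP[/eqP].
pose m : {measure set borelType -> \bar R} := measure_of_charge (re_charge mu) re0.
exists m; split=> // g; rewrite cintegral_real /charge_integral.
case: cid => P hP; case: cid => N hPN.
case: cid => P' hP'; case: cid => N' hPN'.
have [[mP _] [mN negN] PN PN0] := hPN.
have [[mP' _] [mN' _] _ _] := hPN'.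
have int0 (n : {measure set borelType -> \bar R}) :
    (forall A : set borelType, measurable A -> n A = 0%E) -> \int[n]_x g x = 0.
  move=> n0; rewrite /Rintegral (eq_measure_integral mzero).
    by rewrite integral_measure_zero.
  by move=> A mA _; rewrite n0.
have muN (A : set borelType) : measurable A -> re_charge mu (A `&` N) = 0%E.
  move=> mA; apply/eqP; rewrite eq_le re0 andbT; apply: negN => //.
  exact: measurableI.
have -> : \int[jordan_neg hPN]_x g x = 0.
  apply: int0 => A mA; rewrite /= jordan_negE cjordan_negE /crestr0 mem_set//.
  by rewrite -[X in (- X)%E]/(re_charge mu (A `&` N)) muN// oppe0.
have -> : \int[jordan_pos hPN']_x g x = 0.
  apply: int0 => A mA; rewrite /= jordan_posE cjordan_posE /crestr0 mem_set//.
  by rewrite -[LHS]/(im_charge mu (A `&` P')) /im_charge im0.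
have -> : \int[jordan_neg hPN']_x g x = 0.
  apply: int0 => A mA; rewrite /= jordan_negE cjordan_negE /crestr0 mem_set//.
  by rewrite -[X in (- X)%E]/(im_charge mu (A `&` N')) /im_charge im0 oppe0.
rewrite !subr0; congr (_%:C).
rewrite /Rintegral (eq_measure_integral m)// => A mA _.
rewrite /= jordan_posE cjordan_posE /crestr0 mem_set//.
rewrite -[LHS]/(re_charge mu (A `&` P)) -[RHS]/(re_charge mu A).
have AP0 : (A `&` P) `&` (A `&` N) = set0 by rewrite setIACA PN0 setI0.
have : re_charge mu ((A `&` P) `|` (A `&` N)) =
    (re_charge mu (A `&` P) + re_charge mu (A `&` N))%E.
  exact: (@chargeU _ borelType R (re_charge mu) _ _ (measurableI _ _ mA mP)
    (measurableI _ _ mA mN) AP0).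
by rewrite -setIUr PN setIT muN// adde0.
Qed.

Lemma norm_positive_measure mu : positive_measure mu -> `|mu| = mu setT.
Proof.
move=> mu0; have [m [mE _]] := positive_measure_integral mu0.
have muE A : mu A = (fine (m A))%:C.
  have := mu0 A; rewrite mE; case: (mu A) => a b; rewrite lecE /= => /andP[/eqP -> _].
  by [].
rewrite measure_normE /measure_norm muE; congr (_%:C).
suff -> : Defs.total_variation mu setT = m setT by [].
apply/eqP; rewrite eq_le; apply/andP; split; last first.
  rewrite mE; apply: le_trans (normc_le_tv mu borel_setT (@subset_refl _ setT)).
  by rewrite lee_fin; apply: le_trans (normc_Re _); exact: ler_norm.
apply: ge_ereal_sup => _ [n [F [mF FA tF ->]]].
rewrite -sumEFin (eq_bigr (fun i => m (F i))); last first.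
  move=> i _; rewrite muE /= expr0n/= addr0 sqrtr_sqr ger0_norm ?fine_ge0//.
  by rewrite mE.
have mUF : measurable (\big[setU/set0]_(i < n) F i : set borelType).
  by apply: bigsetU_measurable => i _; exact: mF.
rewrite -(@measure_semi_additive_ord _ borelType _ m _ F)//.
by apply: le_measure; rewrite ?inE.
Qed.

(* nu(A) + nu(~A) = 1 while |nu(A)| + |nu(~A)| <= 1. *)
Lemma positive_measure_of_norm nu : `|nu| <= 1 -> nu setT = 1 -> positive_measure nu.
Proof.
move=> n1 nuT; apply: borel_positive_measure => A mA.
have mAC : borel (~` A) by exact: (@measurableC _ borelType).
have tv1 : (Defs.total_variation nu setT <= 1)%E.
  rewrite -(fineK (tv_fin nu)) lee_fin -lerC.
  by rewrite measure_normE in n1.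
have : normc (nu A) + normc (nu (~` A)) <= 1.
  rewrite -lee_fin; apply: le_trans tv1; apply: ereal_sup_ubound.
  exists 2, (fun i => if i == ord0 then A else ~` A); split=> //.
  - by move=> i; case: ifP.
  - apply/trivIsetP => i j _ _; case: i => -[|[|//]] ?; case: j => -[|[|//]] ? //= _.
      by rewrite setICr.
    by rewrite setICl.
  - by rewrite !big_ord_recl big_ord0 addr0.
have nuA : nu A + nu (~` A) = 1.
  by rewrite -regular_measureU ?setICr// setUv.
have := congr1 (@complex.Re R) nuA; rewrite raddfD /=.
have := normc_Re (nu A); have := normc_Re (nu (~` A)).
have := ler_norm (complex.Re (nu A)); have := ler_norm (complex.Re (nu (~` A))).
move=> h1 h2 h3 h4 h5 h6.
(* The real parts of nu(A) and nu(~A) sum to 1 and the moduli to at most 1, so each modulus equals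
   the real part. *)
have : normc (nu A) = complex.Re (nu A) by lra.
move=> {}h; suff -> : nu A = `|nu A| by [].
rewrite normCE h; case: (nu A) h => a b /= h.
have : a ^+ 2 + b ^+ 2 = a ^+ 2.
  by rewrite -[in RHS]h sqr_sqrtr// addr_ge0// sqr_ge0.
by move/eqP; rewrite addrC -subr_eq0 addrK sqrf_eq0 => /eqP ->.
Qed.

End cintegral_facts.

(** * Convolution of probability measures *)

Section convolution.
Context {R : realType} {S : ptopologicalType} {mul : S -> S -> S}.
Hypotheses (S_semitop : semitopological_semigroup mul)
  (S_hausdorff : hausdorff_space S) (S_lc : locally_compact [set: S]).
Local Notation C := (Cplx R).
Local Notation borel := ((@open S).-sigma.-measurable).
Local Notation borelType := (g_sigma_algebraType (@open S)).
Implicit Types (mu nu : regular_measure R S) (B K L : set S).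

Let mul_contl x : continuous (mul x).
Proof. by case: S_semitop. Qed.

Let mul_contr y : continuous (mul ^~ y).
Proof. by case: S_semitop. Qed.

Lemma borel_closed B : closed B -> borel B.
Proof.
move=> cB; rewrite -(setCK B); apply: (@measurableC _ borelType).
by apply: sub_sigma_algebra; exact: closed_openC.
Qed.

Lemma compact_nbhs (y : S) : exists2 L, compact L & nbhs y L.
Proof.
by have [L] := @S_lc y I; rewrite withinET => Ly [cL _]; exists L.
Qed.

(** Regularity at the whole space forces the outer open set to be all of [S], so the variation off
    the inner compact set is small. *)
Lemma probability_tight mu (e : R) : probability_measures mu -> 0 < e ->
  exists2 K, compact K & 1 - e < complex.Re (mu K) /\
    fine (Defs.total_variation mu (~` K)) < e.
Proof.
move=> [mu0 mu1] e0; have [_ _ b r] := regular_measure_prop mu.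
have [K [U [cK _ _ TU tvK]]] := r setT borel_setT e e0.
have mK : borel K by apply: borel_closed; exact: compact_closed.
have mKC : borel (~` K) by exact: (@measurableC _ borelType).
have tvKe : fine (Defs.total_variation mu (~` K)) < e.
  rewrite -lte_fin fineK.
    by apply: le_lt_trans tvK; apply: tv_subset => x; split => //; exact: TU.
  by rewrite ge0_fin_numE ?tv_ge0//; apply: le_lt_trans b; exact: tv_subset.
exists K => //; split=> //.
have /(congr1 (@complex.Re R)) := regular_measure_setIC mu borel_setT mK.
rewrite mu1 !setTI raddfD /= => h.
have : complex.Re (mu (~` K)) <= fine (Defs.total_variation mu (~` K)).
  apply: le_trans (_ : normc (mu (~` K)) <= _).
    by apply: le_trans (normc_Re _); exact: ler_norm.
  rewrite -lee_fin fineK; first exact: normc_le_tv.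
  by rewrite ge0_fin_numE ?tv_ge0//; apply: le_lt_trans b; exact: tv_subset.
move: h tvKe; clear; move: (complex.Re _) (complex.Re _) (fine _) => *; lra.
Qed.

(* If it failed, separately_continuous_seq would give y_n where it fails and
   h(x y_n) --> 1 on a compact set of mu-mass > 1 - e: dominated convergence
   applies to sequences, but not to the neighborhood filter of y0. *)
Lemma translate_tight mu (e : R) (y0 : S) : probability_measures mu -> 0 < e ->
  exists2 K, compact K &
    \forall y \near y0, 1 - e <= complex.Re (mu (mul ^~ y @^-1` K)).
Proof.
move=> pmu e0; have [mu0 mu1] := pmu.
have [K cK [muK _]] := probability_tight pmu e0.
have mK : borel K by apply: borel_closed; exact: compact_closed.
have [L cL Ly0] := compact_nbhs y0.
have [h [hC h01 h1 hc]] := @urysohn_compact R S S_lc S_hausdorff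
  (mul ^~ y0 @` K) (continuous_compact (continuous_subspaceT (@mul_contr y0)) cK).
(* As h = 1 on K y0, convergence h(x y_n) --> 1 for x in [K] places x y_n eventually in the compact
   set where h >= 1/2. *)
have cK' := hc 2^-1 ltac:(by []); set K' := (X in compact X) in cK'.
exists K' => //; apply: contrapT => nB.
pose B := [set y | complex.Re (mu (mul ^~ y @^-1` K')) < 1 - e].
have By0 : closure B y0.
  move=> U Uy0; apply: contrapT => BU; apply: nB; apply: filterS Uy0 => y Uy.
  by rewrite leNgt; apply/negP => By; apply: BU; exists y.
have [|x|y [By hy]] := @separately_continuous_seq R S S (fun x y => h (mul x y))
  _ _ K L B y0 cK cL Ly0 By0.
- by move=> y x; apply: continuous_comp; [exact: mul_contr|exact: hC].
- by move=> y; apply: continuous_comp; [exact: mul_contl|exact: hC].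
have [m [mE _]] := positive_measure_integral mu0.
pose E n : set borelType := mul ^~ (y n) @^-1` K'.
have mK' : closed K' by exact: compact_closed.
have mE' n : measurable (E n).
  by apply: borel_closed; apply: closed_comp => // x _; exact: mul_contr.
(* The indicators of [E n] tend to 1 pointwise on [K]. In the limit mu(K) <= 1 - e, against the
   choice of [K]. *)
have : (\int[m]_(x in K) (\1_(E n) x)%:E)%E @[n --> \oo] --> (\int[m]_(x in K) 1)%E.
  apply: (@dominated_cvg _ borelType _ m K mK _ _ (cst 1%E)).
  - by move=> n; apply/measurable_EFinP; exact: measurable_indic.
  - move=> x Kx; apply: cvg_near_cst; have := hy x Kx; rewrite h1; last by exists x.
    move=> /cvgrPdist_lt/(_ 2^-1 ltac:(by [])); apply: filterS => n hn.
    rewrite indicE mem_set// /E /K' /=.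
    by have := ler_norm (1 - h (mul x (y n))); lra.
  - by [].
  - apply/integrableP; split; first exact: measurable_cst.
    by rewrite integral_cst//= normr1 mul1e mE ltry.
  - by move=> n x Kx; rewrite /= lee_fin ger0_norm// indicE; case: (_ \in _).
move=> cvgE; have : (\int[m]_(x in K) 1 <= (1 - e)%:E)%E.
  rewrite -(cvg_lim _ cvgE)//; apply: lime_le.
    by apply/cvg_ex; eexists; exact: cvgE.
  apply: nearW => n; rewrite integral_indic//.
  apply: (@le_trans _ _ (m (E n))); last by rewrite mE lee_fin; exact/ltW/By.
  by apply: le_measure; rewrite ?inE//; exact: measurableI.
by rewrite integral_cst// mul1e mE lee_fin leNgt muK.
Qed.

Lemma continuous_real_complex (h : S -> R) : continuous h ->
  continuous (fun x => (h x)%:C : C).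
Proof.
move=> hC x; apply/cvgrPdist_lt => -[e e'] /[dup] e0.
rewrite ltcE /= => /andP[/eqP e'0 {}e0].
have /cvgrPdist_lt/(_ _ e0) := hC x; apply: filterS => z hz.
rewrite -rmorphB normCE e'0 ltcR /= expr0n/= addr0 sqrtr_sqr//.
Qed.

Variable A : convolution_algebra R mul.

(** One test function [h] sees both sides. It is 1 on [K0], off which mu * nu has variation below e,
    and on finitely many [K y], which hold mass at least 1 - e of the translates of [mu] by points
    of [L]. Hence (1 - e)^2 is at most the double integral of [h], which is at most the real mass
    plus e, and (1 - e)^2 - e >= 1 - 3e. *)
Lemma convolution_mass mu nu (e : R) : probability_measures mu ->
  probability_measures nu -> 0 < e -> e < 1 ->
  1 - 3 * e <= complex.Re (A mu nu setT).
Proof.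
move=> pmu pnu e0 e1; have [mu0 mu1] := pmu; have [nu0 nu1] := pnu.
have arith (a t c i : R) : i <= a + t -> t < e -> 1 - e < c ->
    (1 - e) * c <= i -> 1 - 3 * e <= a.
  clear -e0 e1 => h1 h2 h3 h4; have : (1 - e) * (1 - e) <= (1 - e) * c.
    by rewrite ler_pM2l; lra.
  have : 0 <= e * e by rewrite mulr_ge0// ltW.
  nra.
have [_ _ b r] := regular_measure_prop (A mu nu).
have [K0 [U [cK0 _ _ TU tvK0]]] := r setT borel_setT e e0.
have [L cL [nuL _]] := probability_tight pnu e0.
have tightE y := cid2 (translate_tight y pmu e0).
pose K y := sval (tightE y).
have [cK nearK] : (forall y, compact (K y)) /\ forall y0, \forall y \near y0,
    1 - e <= complex.Re (mu (mul ^~ y @^-1` K y0)).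
  by split=> y; rewrite /K; case: (tightE y).
have [D [_ LD]] := compact_finite_subcover cL (fun y _ => nearK y).
pose K1 := K0 `|` \bigcup_(y in [set` D]) K y.
have cK1 : compact K1.
  by apply: compactU => //; rewrite bigcup_seq; exact: bigsetU_compact.
have [h [hC h01 h1 hc]] := @urysohn_compact R S S_lc S_hausdorff K1 cK1.
have h0 x : 0 <= h x by have /andP[] := h01 x.
have hle1 x : h x <= 1 by have /andP[] := h01 x.
have vh : vanishing_at_infinity (fun x => (h x)%:C : C).
  split; first exact: continuous_real_complex.
  move=> t t0; rewrite (_ : mkset _ = [set x | t <= h x]); first exact: hc.
  apply/seteqP; split=> x /=; rewrite normCE lecR /= expr0n/= addr0 sqrtr_sqr ger0_norm//.
have [m [mE mint]] := positive_measure_integral mu0.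
have [l [lE lint]] := positive_measure_integral nu0.
have mfin : (m setT < +oo)%E by rewrite mE ltry.
have lfin : (l setT < +oo)%E by rewrite lE ltry.
have intE := conv_integral A mu nu vh.
pose Phi y := \int[m]_x h (mul x y).
have PhiE : (fun y => cintegral mu (fun x => (h (mul x y))%:C)) =
    (fun y => (Phi y)%:C).
  by apply/funext => y; exact: (mint (fun x => h (mul x y))).
rewrite PhiE cintegral_real lint in intE; have [{}intE _] := intE.
have mK0 : borel K0 by apply: borel_closed; exact: compact_closed.
have := charge_integral_le_mass (A mu nu) mK0 h01
  (fun x K0x => h1 x (or_introl K0x)).
rewrite intE => le_mass.
have tvKe : fine (Defs.total_variation (A mu nu) (~` K0)) < e.
  rewrite -lte_fin fineK.
    by apply: le_lt_trans tvK0; apply: tv_subset => x; split => //; exact: TU.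
  by rewrite ge0_fin_numE ?tv_ge0//; apply: le_lt_trans b; exact: tv_subset.
have Phi0 y : 0 <= Phi y by apply: Rintegral_ge0.
have mT : measurable [set: borelType] by exact: measurableT.
have Phi1 y : Phi y <= 1.
  apply: (@le_trans _ _ (\int[m]_x \1_setT x)).
    by apply: le_RintegralT => // x; rewrite indicT.
  by rewrite Rintegral_indicT// mE /= mu1.
have PhiL y : L y -> 1 - e <= Phi y.
  move=> /LD[y0 Dy0] /le_trans; apply.
  have mKy : measurable (mul ^~ y @^-1` K y0 : set borelType).
    apply: borel_closed; apply: closed_comp => [x _|]; first exact: mul_contr.
    exact: compact_closed.
  rewrite (_ : complex.Re _ = fine (m (mul ^~ y @^-1` K y0))) ?mE//.
  rewrite -mE -Rintegral_indicT//; apply: le_RintegralT => // x.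
  rewrite indicE; case: (boolP (x \in _)) => //; rewrite inE => Kx.
  by rewrite h1//; right; exists y0.
have mL : measurable (L : set borelType).
  by apply: borel_closed; exact: compact_closed.
(* [Phi] is bounded below by the simple function (1 - e) 1_L. Monotonicity is used in the form valid
   for nonnegative functions whose measurability has not been established, as is the case of
   [Phi]. *)
have : (1 - e) * complex.Re (nu L) <= \int[l]_y (Phi : borelType -> R) y.
  apply: (@le_trans _ _ (\int[l]_y ((1 - e) * \1_(L : set borelType) y))); last first.
    apply: le_RintegralT => // y; first by rewrite mulr_ge0// subr_ge0 ltW.
    rewrite indicE; case: (boolP (y \in _)) => [|_]; last by rewrite mulr0.
    by rewrite inE mulr1 => /PhiL.
  rewrite RintegralZl//.
    by rewrite Rintegral_indicT// lE.
  apply/integrableP; split; first by apply/measurable_EFinP; exact: measurable_indic.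
  rewrite (eq_integral (fun y : borelType => (\1_(L : set borelType) y)%:E)).
    by rewrite integral_indic// setIT lE ltry.
  by move=> y _ /=; rewrite ger0_norm// indicE; case: (_ \in _).
move=> le_int; exact: arith le_mass tvKe nuL le_int.
Qed.

Lemma convolution_probability mu nu : probability_measures mu ->
  probability_measures nu -> probability_measures (A mu nu).
Proof.
move=> pmu pnu; have [mu0 mu1] := pmu; have [nu0 nu1] := pnu.
have n1 : `|A mu nu| <= 1.
  apply: le_trans (conv_norm A mu nu) _.
  by rewrite !norm_positive_measure// mu1 nu1 mulr1.
suff nuT : A mu nu setT = 1 by split=> //; exact: positive_measure_of_norm.
have Re1 : 1 <= complex.Re (A mu nu setT).
  apply/ler_addgt0Pr => e e0.
  (* This choice gives both 3t <= e and t < 1. *)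
  pose t := Num.min (e / 3) 2^-1.
  have t0 : 0 < t by rewrite lt_min divr_gt0//= invr_gt0.
  have t1 : t < 1 by rewrite gt_min; apply/orP; right; lra.
  have te : 3 * t <= e.
    by rewrite mulrC -ler_pdivlMr// ge_min lexx.
  by have := convolution_mass pmu pnu t0 t1; lra.
have N1 : normc (A mu nu setT) <= 1.
  rewrite -lee_fin.
  apply: le_trans (normc_le_tv (A mu nu) borel_setT (@subset_refl _ _)) _.
  rewrite -(fineK (tv_fin _)) lee_fin -lerC.
  by rewrite measure_normE in n1.
(* A complex number of real part at least 1 and modulus at most 1 is 1. *)
case: (A mu nu setT) Re1 N1 => a b /= a1 ab1.
have : a ^+ 2 + b ^+ 2 <= 1.
  by rewrite -(expr1n R 2) -(@sqr_sqrtr _ (a ^+ 2 + b ^+ 2)) ?addr_ge0 ?sqr_ge0//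
    ler_sqr ?nnegrE ?sqrtr_ge0.
have b20 : 0 <= b ^+ 2 by exact: sqr_ge0.
have a2 : 1 <= a ^+ 2 by rewrite expr_ge1//; lra.
have a_le : a <= a ^+ 2 by rewrite ler_eXnr.
move=> h; have /eqP : b ^+ 2 = 0 by lra.
rewrite sqrf_eq0 => /eqP ->; congr (_ +i* _); lra.
Qed.

End convolution.

(** * Weak topologies *)

Section weak_topology_facts.
Context {R : realType} {V : normedModType R[i]}.
Local Notation C := (Cplx R).

Lemma topdual_continuous (phi : topdual V) : continuous (phi : V -> C).
Proof.
move=> x; apply/cvgrPdist_lt => e e0.
have k0 : 0 < dual_norm phi + 1 by rewrite ltr_wpDl// dual_norm_ge0.
have /cvgrPdist_lt/(_ (e / (dual_norm phi + 1))) := @cvg_id _ (nbhs x).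
rewrite divr_gt0// => /(_ isT); apply: filterS => z hz.
have -> : phi x - phi z = phi (x - z).
  by rewrite [in RHS]addrC -(scaleN1r z) dual_linear mulN1r addrC.
apply: le_lt_trans (dual_norm_bound phi _) _.
apply: le_lt_trans (_ : (dual_norm phi + 1) * `|x - z| < _).
  by rewrite ler_wpM2r// lerDl.
by rewrite mulrC -ltr_pdivlMr.
Qed.

Lemma weak_eval_continuous (phi : topdual V) :
  continuous (phi : weak_topology V -> C).
Proof.
move=> x; apply: (@continuous_comp (weak_topology V) {ptws topdual V -> C} C
  (fun x : V => (fun phi : topdual V => phi x) : {ptws topdual V -> C})
  (fun h => h phi)).
  exact: initial_continuous.
exact: (@proj_continuous _ (fun=> C) phi).
Qed.

Lemma continuous_to_weak (T : topologicalType) (g : T -> weak_topology V) :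
  (forall phi : topdual V, continuous (fun t => phi (g t) : C)) -> continuous g.
Proof.
move=> hg; apply: continuous_comp_initial => t.
apply/pointwise_cvgP => phi; exact: hg.
Qed.

(** If |g| < 1 on the ball of radius e, rescaling a nonzero x to norm e/2 gives the constant 2/e. *)
Lemma continuous0_bounded_linear (g : V -> C) :
  (forall (a : C) x y, g (a *: x + y) = a * g x + g y) ->
  {for 0, continuous g} -> bounded_linear_functional g.
Proof.
move=> ling; split=> //.
have g0 : g 0 = 0.
  have := ling 1 0 0; rewrite scaler0 addr0 mul1r => h.
  by apply: (addrI (g 0)); rewrite -h addr0.
have gZ a x : g (a *: x) = a * g x by have := ling a x 0; rewrite !addr0 g0 addr0.
move: H => /cvgrPdist_lt/(_ 1 ltr01) /nbhs_norm0P[e /= e0 He].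
(* The radius is an element of [R[i]]; being positive, it is real. *)
have eE : e = (complex.Re e)%:C.
  by move: e0; case: (e) => a b; rewrite ltcE /= => /andP[/eqP ->].
exists (2 / complex.Re e) => x.
have [->|x0] := eqVneq x 0; first by rewrite g0 !normr0 mulr0.
have nx : 0 < `|x| by rewrite normr_gt0.
have c0 : 0 < e / 2 / `|x| by rewrite !divr_gt0.
have := He ((e / 2 / `|x|) *: x); rewrite /= normrZ (gtr0_norm c0) divfK ?gt_eqF//.
rewrite ltr_pdivrMr// ltr_pMr// ltr1n => /(_ isT).
rewrite g0 sub0r normrN gZ normrM (gtr0_norm c0) => /ltW.
rewrite -ler_pdivlMl// mulr1 !invfM !invrK => h.
have -> : (2 / complex.Re e)%:C = 2 / e by rewrite [in RHS]eE rmorphM fmorphV rmorph_nat.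
by rewrite [2 / e]mulrC.
Qed.

End weak_topology_facts.

Section bounded_maps.
Context {R : realType} {V W : normedModType R[i]}.
Local Notation C := (Cplx R).
Variable (f : V -> W) (k : R).
Hypothesis linf : forall (a : C) x y, f (a *: x + y) = a *: f x + f y.
Hypothesis bndf : forall x, `|f x| <= k%:C * `|x|.

(** Composition with a bounded linear map pulls W^* back into V^*, and elements of V^* are weakly
    continuous by construction. *)
Lemma bounded_linear_weak_continuous :
  continuous (f : weak_topology V -> weak_topology W).
Proof.
apply: continuous_to_weak => phi.
have phif : (fun x => phi (f x)) \in @dual_pred R V.
  apply/asboolP; split; first by move=> a x y; rewrite linf dual_linear.
  exists (sup (unit_ball_values phi) * k) => x.
  apply: le_trans (dual_norm_bound phi _) _.
  by rewrite rmorphM -mulrA ler_wpM2l// dual_norm_ge0.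
exact: (@weak_eval_continuous R V (Dual phif)).
Qed.

End bounded_maps.

(** * Means and sublinear majorant *)

Section dirac.
Context {R : realType} {S : ptopologicalType}.
Hypothesis S_hausdorff : hausdorff_space S.
Local Notation C := (Cplx R).
Local Notation borel := ((@open S).-sigma.-measurable).
Variable s : S.

Let delta (A : set S) : C := (`[< borel A /\ A s >])%:R.

Let deltaE A : borel A -> delta A = (`[< A s >])%:R.
Proof.
move=> mA; rewrite /delta; congr (_%:R); congr nat_of_bool.
by apply: asbool_equiv_eq; split=> [[]|].
Qed.

Let delta_disjoint n (F : 'I_n -> set S) : (forall i, borel (F i)) ->
  trivIset setT F -> forall k, F k s -> forall i, delta (F i) = (i == k)%:R.
Proof.
move=> mF tF k Fks i; rewrite deltaE//; congr (_%:R); congr nat_of_bool.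
apply/asboolP/eqP => [Fis|->//].
by apply: tF => //; exists s.
Qed.

(** For regularity, take K = {s} and U = S if [s] lies in the set, and K empty and U = S minus {s}
    otherwise; points are closed since [S] is Hausdorff. In both cases U minus K misses [s]. *)
Fact dirac_subproof : delta \in @regular_measure_pred R S.
Proof.
have tvE A : ~ A s -> Defs.total_variation delta A = 0%E.
  move=> nAs; apply/eqP; rewrite eq_le tv_ge0 andbT.
  apply: ge_ereal_sup => _ [n [F [mF FA tF ->]]].
  rewrite big1// => i _; rewrite deltaE// asboolF ?normc_zero//.
  by move=> /FA.
have delta0 A : ~ A s -> delta A = 0 by move=> nAs; rewrite /delta asboolF// => -[].
apply/asboolP; split.
- by move=> A nA; rewrite /delta asboolF// => -[].
- move=> F mF tF; have mUF : borel (\bigcup_i F i).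
    exact: (@bigcupT_measurable _ (g_sigma_algebraType (@open S))).
  have [[k Fk]|nF] := pselect (exists k, F k s); last first.
    rewrite (delta0 (\bigcup_i F i)); last by move=> [k _ Fk]; apply: nF; exists k.
    rewrite (_ : (fun n => _) = fun=> 0); first exact: cvg_cst.
    apply/funext => n; rewrite big1// => i _; apply: delta0 => Fi.
    by apply: nF; exists i.
  rewrite (deltaE mUF) asboolT; last by exists k.
  apply: cvg_near_cst; exists k.+1 => // n /= kn.
  rewrite (bigD1 (Ordinal kn))//= big1 ?addr0.
    by rewrite deltaE// asboolT.
  move=> i ik; apply: delta0 => Fi; move/eqP: ik; apply; apply: val_inj => /=.
  by apply: tF => //; exists s.
- apply: (@le_lt_trans _ _ 1%E); last exact: ltry.
  apply: ge_ereal_sup => _ [n [F [mF FA tF ->]]].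
  have [[k Fk]|nF] := pselect (exists k, F k s); last first.
    rewrite big1 ?lee_fin ?ler01// => i _; rewrite delta0 ?normc_zero// => Fi.
    by apply: nF; exists i.
  rewrite (bigD1 k)//= big1 ?addr0.
    by rewrite (delta_disjoint mF tF Fk) eqxx /= expr1n expr0n/= addr0 sqrtr1.
  by move=> i ik; rewrite (delta_disjoint mF tF Fk) (negbTE ik) normc_zero.
- move=> A mA e e0; have [As|nAs] := pselect (A s).
    exists [set s], setT; split=> //; first exact: compact_set1.
    - exact: openT.
    - by move=> _ ->.
    - by rewrite tvE ?lte_fin// => -[_]; apply.
  exists set0, (~` [set s]); split=> //; first exact: compact0.
  - apply: closed_openC; apply: accessible_closed_set1.
    exact: hausdorff_accessible.
  - by move=> x Ax /= xs; apply: nAs; rewrite -xs.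
  - by rewrite tvE ?lte_fin// => -[/(_ erefl)].
Qed.

Definition dirac_measure : regular_measure R S := RegularMeasure dirac_subproof.

Lemma dirac_probability : probability_measures dirac_measure.
Proof.
split; first by move=> A; exact: ler0n.
by rewrite -[LHS]/(delta setT) deltaE ?asboolT//; exact: borel_setT.
Qed.

End dirac.

(** * Functionals on M(S)^* dominated by [sup_re] *)

Section functionals.
Context {R : realType} {S : ptopologicalType}.
Hypothesis S_hausdorff : hausdorff_space S.
Local Notation C := (Cplx R).
Local Notation M := (regular_measure R S).
Implicit Types (mu nu : M) (f g : topdual M) (X : set (topdual M)).

Lemma topdual_eq_probability f g :
  (forall mu, probability_measures mu -> f mu = g mu) -> f = g.
Proof.
move=> fg; apply/val_inj/funext => mu.
by apply: linear_eq_probability fg mu => a x y; rewrite dual_linear.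
Qed.

Lemma nonneg_functional_probability f :
  (forall mu, probability_measures mu -> 0 <= f mu) -> nonneg_functional f.
Proof.
move=> f0 mu mu0; have [->|/eqP nz] := eqVneq mu 0; first by rewrite dual0.
have nz' : mu setT != 0 by apply/eqP => /(positive_measure_eq0 mu0).
rewrite -[mu]scale1r -(divff nz') -scalerA dualZ mulr_ge0//.
exact/f0/positive_measure_normalize.
Qed.

Lemma normc_functional_probability f mu : probability_measures mu ->
  normc (f mu) <= sup (unit_ball_values f).
Proof.
move=> [mu0 mu1]; rewrite -lerC -normCE; apply: le_trans (dual_norm_bound f mu) _.
by rewrite norm_positive_measure// mu1 mulr1.
Qed.

Definition sup_re f : R :=
  sup [set complex.Re (f mu) | mu in @probability_measures R S].

Let has_sup_re f :
  has_sup [set complex.Re (f mu) | mu in @probability_measures R S].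
Proof.
split.
  pose d : M := dirac_measure S_hausdorff point.
  by exists (complex.Re (f d)), d => //; exact: dirac_probability.
exists (sup (unit_ball_values f)) => _ [mu pmu <-].
apply: le_trans (normc_functional_probability f pmu).
by apply: le_trans (normc_Re _); exact: ler_norm.
Qed.

Lemma sup_re_ub f mu : probability_measures mu -> complex.Re (f mu) <= sup_re f.
Proof. by move=> pmu; apply: ub_le_sup; [case: (has_sup_re f)|exists mu]. Qed.

Lemma sup_re_le f (k : R) :
  (forall mu, probability_measures mu -> complex.Re (f mu) <= k) ->
  sup_re f <= k.
Proof.
by move=> h; apply: ge_sup; [case: (has_sup_re f)|move=> _ [mu pmu <-]; exact: h].
Qed.

Lemma sup_reD f g : sup_re (f + g) <= sup_re f + sup_re g.
Proof.
apply: sup_re_le => mu pmu; rewrite -[(f + g) mu]/(f mu + g mu) raddfD /=.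
by apply: lerD; exact: sup_re_ub.
Qed.

Lemma ReZ (r : R) (z : R[i]) : complex.Re (r%:C * z) = r * complex.Re z.
Proof. by case: z => a b /=; rewrite mul0r subr0. Qed.

Lemma sup_reZ (r : R) f : 0 < r -> sup_re (r%:C *: f) = r * sup_re f.
Proof.
move=> r0; apply/eqP; rewrite eq_le; apply/andP; split.
  apply: sup_re_le => mu pmu; rewrite -[(r%:C *: f) mu]/(r%:C * f mu) ReZ.
  by rewrite ler_pM2l//; exact: sup_re_ub.
rewrite -ler_pdivlMl//; apply: sup_re_le => mu pmu.
by rewrite ler_pdivlMl// -ReZ; exact: (sup_re_ub (r%:C *: f)).
Qed.

Section mean.
Variables (X : set (topdual M)) (m : topdual M -> C).
Hypotheses (linX : linear_subspace X) (saX : self_adjoint X)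
  (X1 : X (total_mass R S)).
Hypothesis linm : forall (a : C) f g, X f -> X g -> m (a *: f + g) = a * m f + m g.
Hypothesis posm : forall f, X f -> nonneg_functional f -> 0 <= m f.
Hypothesis m1 : m (total_mass R S) = 1.

(** Positivity is applied to (sup_re f) 1 - f. In [R[i]], being nonnegative includes being real,
    which gives both conclusions. *)
Let mean_real f : X f ->
  (forall mu, probability_measures mu -> complex.Im (f mu) = 0) ->
  complex.Im (m f) = 0 /\ complex.Re (m f) <= sup_re f.
Proof.
move=> Xf ref; have [X0 XD] := linX.
have m0 : m 0 = 0.
  have := linm 1 X0 X0; rewrite scaler0 addr0 mul1r => h.
  by apply: (addrI (m 0)); rewrite -h addr0.
pose g := (sup_re f)%:C *: total_mass R S + ((-1 : C) *: f + 0).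
have XNf : X ((-1 : C) *: f + 0) by exact: (XD).
have : 0 <= m g.
  apply: posm; first exact: XD.
  apply: nonneg_functional_probability => mu pmu.
  rewrite -[g mu]/((sup_re f)%:C * mu setT + (-1 * f mu + 0)).
  have [_ ->] := pmu; rewrite mulr1 addr0 mulN1r.
  have := sup_re_ub f pmu; have := ref mu pmu; case: (f mu) => a b /= -> ha.
  by rewrite lecE /= oppr0 addr0 eqxx subr_ge0.
rewrite linm// linm// m0 m1 mulr1 addr0 mulN1r lecE.
by case: (m f) => a b /=; rewrite add0r oppr_eq0 subr_ge0 => /andP[/eqP -> ->].
Qed.

(** Write f = h + ik with [h] and [k] real on probabilities; self-adjointness keeps both in [X].
    Since m(k) is real, Re m(f) = Re m(h) <= sup_re h, and h(mu) = Re f(mu) on probabilities. *)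
Lemma mean_le_sup_re f : X f -> complex.Re (m f) <= sup_re f.
Proof.
move=> Xf; have [X0 XD] := linX.
pose h := (2^-1 : C) *: (1 *: f + conj_dual f) + 0.
pose k := (- ('i%C : C) / 2) *: ((-1 : C) *: conj_dual f + f) + 0.
have Xc := saX Xf.
have Xh : X h by apply: (XD) => //; exact: XD.
have Xk : X k by apply: (XD) => //; exact: XD.
have conjE mu : probability_measures mu -> conj_measure mu = mu.
  move=> [mu0 _]; apply: regular_measure_ext => A _.
  rewrite -[LHS]/((mu A)^*); have := mu0 A; case: (mu A) => a b.
  by rewrite lecE /= => /andP[/eqP -> _]; rewrite oppr0.
have cfE mu : probability_measures mu -> conj_dual f mu = (f mu)^*.
  by move=> pmu; rewrite /= conjE.
have hE mu : probability_measures mu -> h mu = (complex.Re (f mu))%:C.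
  move=> pmu; rewrite -[LHS]/(2^-1 * (1 * f mu + conj_dual f mu) + 0) cfE//.
  rewrite mul1r addr0; case: (f mu) => a b.
  have -> : (a +i* b) + (a +i* b)^* = 2 * a%:C.
    by rewrite mulr_natl mulr2n; apply/eqP; rewrite eq_complex /= subrr addr0 !eqxx.
  by rewrite mulrA mulVf ?mul1r// pnatr_eq0.
have kE mu : probability_measures mu -> k mu = (complex.Im (f mu))%:C.
  move=> pmu.
  rewrite -[LHS]/(- 'i%C / 2 * (- 1 * conj_dual f mu + f mu) + 0) cfE//.
  rewrite addr0; case: (f mu) => a b.
  have -> : - 1 * (a +i* b)^* + (a +i* b) = 2 * ('i%C * b%:C).
    rewrite mulr_natl mulr2n mulN1r; apply/eqP; rewrite eq_complex /=.
    by apply/andP; split; apply/eqP; ring.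
  have halfK (z w : R[i]) : z / 2 * (2 * w) = z * w.
    by rewrite mulrA divfK// pnatr_eq0.
  rewrite [LHS]halfK mulrA mulNr -expr2 sqr_i opprK mul1r//.
have [_ le_h] := mean_real Xh (fun mu pmu => congr1 (@complex.Im R) (hE mu pmu)).
have [im_k _] := mean_real Xk (fun mu pmu => congr1 (@complex.Im R) (kE mu pmu)).
have -> : f = ('i%C : C) *: k + h.
  apply: topdual_eq_probability => mu pmu.
  rewrite -[RHS]/('i%C * k mu + h mu) hE// kE//; case: (f mu) => a b.
  by apply/eqP; rewrite eq_complex /=; apply/andP; split; apply/eqP; ring.
rewrite linm// raddfD /=; apply: le_trans (_ : complex.Re (m h) <= _).
  by move: im_k; case: (m k) => a b /= ->; rewrite mul0r mulr0 subr0 add0r.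
apply: le_trans le_h _; apply: sup_re_le => mu pmu.
rewrite hE//= -[X in X <= _]add0r; apply: le_trans _ (sup_re_ub _ pmu).
by rewrite -[(_ + h) mu]/('i%C * k mu + h mu) hE// kE//= !mul0r !mulr0 subr0.
Qed.

End mean.

Section dominated.
Variable n : topdual M -> C.
Hypothesis linn : forall (a : C) f g, n (a *: f + g) = a * n f + n g.
Hypothesis len : forall f, complex.Re (n f) <= sup_re f.

Let nZ (a : C) f : n (a *: f) = a * n f.
Proof.
have n0 : n 0 = 0.
  have := linn 1 0 0; rewrite scaler0 addr0 mul1r => h.
  by apply: (addrI (n 0)); rewrite -h addr0.
by have := linn a f 0; rewrite !addr0 n0 addr0.
Qed.

(** Applying the majorant to f, -f, if and -if bounds the real and imaginary parts of n(f) by the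
    norm of f, whence the constant 2. *)
Lemma dominated_bounded : bounded_linear_functional n.
Proof.
split=> //; exists 2 => f.
have re_le (a : C) : normc a = 1 -> complex.Re (a * n f) <= sup (unit_ball_values f).
  move=> a1; rewrite -nZ; apply: le_trans (len _) _; apply: sup_re_le => mu pmu.
  rewrite -[(a *: f) mu]/(a * f mu); apply: le_trans (normc_functional_probability f pmu).
  apply: le_trans (ler_norm _) _; apply: le_trans (normc_Re _) _.
  by rewrite normcM a1 mul1r.
have n1 : normc (1 : C) = 1 by rewrite /= expr1n expr0n/= addr0 sqrtr1.
have ni : normc ('i%C : C) = 1 by rewrite /= expr1n expr0n/= add0r sqrtr1.
have nN (a : C) : normc (- a) = normc a.
  by case: a => a b /=; rewrite !sqrrN.
have := re_le 1 n1; have := re_le (- 1) (etrans (nN 1) n1).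
have := re_le 'i%C ni; have := re_le (- 'i%C) (etrans (nN 'i%C) ni).
rewrite -[`|f|]/(dual_norm f) /dual_norm -rmorphM normCE lecR.
case: (n f) => a b h1 h2 h3 h4.
have : normc (a +i* b) <= `|a| + `|b|.
  have -> : a +i* b = a%:C + 'i%C * b%:C.
    by apply/eqP; rewrite eq_complex /=; apply/andP; split; apply/eqP; ring.
  apply: le_trans (normcD _ _) _; rewrite normcM ni mul1r.
  by rewrite /= !expr0n/= !addr0 !sqrtr_sqr.
move: h1 h2 h3 h4; simpc; rewrite /= => h1 h2 h3 h4 h5.
have : `|a| <= sup (unit_ball_values f) by rewrite ler_norml; lra.
have : `|b| <= sup (unit_ball_values f) by rewrite ler_norml; lra.
lra.
Qed.

(** The majorant is at most 0 at -f, if and -if: the first gives Re n(f) >= 0, the other two Im n(f)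
    = 0. *)
Lemma dominated_nonneg f : nonneg_functional f -> 0 <= n f.
Proof.
move=> f0; have pos mu : probability_measures mu -> 0 <= f mu.
  by move=> [mu0 _]; exact: f0.
have le0 (a : C) : (forall mu, probability_measures mu -> complex.Re (a * f mu) <= 0) ->
    complex.Re (a * n f) <= 0.
  by move=> h; rewrite -nZ; apply: le_trans (len _) _; apply: sup_re_le => mu /h.
have h1 : complex.Re (-1 * n f) <= 0.
  apply: le0 => mu /pos; case: (f mu) => a b; rewrite lecE mulN1r /= => /andP[_].
  by rewrite oppr_le0.
have h2 : complex.Re ('i%C * n f) <= 0.
  apply: le0 => mu /pos; case: (f mu) => a b; rewrite lecE /= => /andP[/eqP -> _].
  by rewrite mul0r mulr0 subr0.
have h3 : complex.Re (- 'i%C * n f) <= 0.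
  apply: le0 => mu /pos; case: (f mu) => a b; rewrite lecE /= => /andP[/eqP -> _].
  by rewrite oppr0 mul0r mulr0 subr0.
move: h1 h2 h3; case: (n f) => a b; rewrite lecE /= => h1 h2 h3.
apply/andP; split; last by lra.
by apply/eqP; lra.
Qed.

End dominated.
End functionals.

(** * The two implications *)

Section translation.
Context {R : realType} {S : ptopologicalType} {mul : S -> S -> S}.
Hypotheses (S_semitop : semitopological_semigroup mul)
  (S_hausdorff : hausdorff_space S) (S_lc : locally_compact [set: S]).
Variable A : convolution_algebra R mul.
Local Notation C := (Cplx R).
Local Notation M := (regular_measure R S).
Local Notation T := (fun mu f => translate A f mu).
Implicit Types (mu nu : M) (f : topdual M).

Lemma norm_translate f mu : `|translate A f mu| <= `|mu| * `|f|.
Proof.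
rewrite mulrC -[`|f|]/(dual_norm f) /dual_norm measure_normE /measure_norm -rmorphM.
apply: dual_norm_le => la la1; rewrite rmorphM.
apply: le_trans (dual_norm_bound f (A mu la)) _.
rewrite ler_wpM2l ?dual_norm_ge0//; apply: le_trans (conv_norm A mu la) _.
by rewrite ler_piMr.
Qed.

(** The algebraic clauses come from bilinearity and associativity of convolution; positivity and the
    fixing of 1 come from its preserving probabilities. *)
Lemma translate_right_action : right_action A T.
Proof.
split.
- by move=> f a mu nu; apply/val_inj/funext => la /=; rewrite conv_linearl dual_linear.
- by move=> mu a f g; exact/val_inj/funext.
- by move=> mu nu f; apply/val_inj/funext => la /=; rewrite Defs.convA.
- move=> mu f pmu f0; apply: nonneg_functional_probability => nu pnu.
  by apply: f0; case: (convolution_probability S_semitop S_hausdorff S_lc A pmu pnu).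
- move=> mu pmu; apply: topdual_eq_probability => nu pnu.
  have [_ munu1] := convolution_probability S_semitop S_hausdorff S_lc A pmu pnu.
  by have [_ nu1] := pnu; rewrite /= munu1 nu1.
Qed.

Lemma translate_weakly_separately_continuous : weakly_separately_continuous T.
Proof.
split=> [f|mu].
  apply: (@bounded_linear_weak_continuous R M (topdual M)
    (fun mu => translate A f mu) (sup (unit_ball_values f))).
    by move=> a mu nu; exact: (action_linearl translate_right_action).
  by move=> mu; rewrite mulrC; exact: norm_translate.
apply: (@bounded_linear_weak_continuous R (topdual M) (topdual M)
  (fun f => translate A f mu) (fine (Defs.total_variation mu setT))).
  by move=> a f g; exact: (action_linearr translate_right_action).
by move=> f; exact: norm_translate.
Qed.

Lemma extension_left_invariant :
  (forall T : M -> topdual M -> topdual M,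
    right_action A T -> weakly_separately_continuous T ->
    forall X : set (topdual M),
      linear_subspace X -> self_adjoint X -> invariant_subset T X ->
      X (total_mass R S) ->
      forall m : topdual M -> C, invariant_mean_on T X m ->
        exists m' : topdual M -> C,
          invariant_mean_on T setT m' /\ forall f, X f -> m' f = m f) ->
  exists m : topdual M -> C,
    mean_on setT m /\ topologically_left_invariant A m.
Proof.
move=> ext; have T1 := action_one translate_right_action.
have [d0 d1] := dirac_probability (R := R) S_hausdorff point.
set d := dirac_measure _ _ in d0 d1.
pose X : set (topdual M) := [set f | exists c : C, f = c *: total_mass R S].
have TX mu f : probability_measures mu -> X f -> translate A f mu = f.
  move=> pmu [c ->]; rewrite -[c *: _]addr0.
  rewrite (action_linearr translate_right_action) T1//; congr (_ + _).
  by apply/val_inj/funext.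
have linX : linear_subspace X.
  split; first by exists 0; rewrite scale0r.
  by move=> a _ _ [c ->] [c' ->]; exists (a * c + c'); rewrite scalerDl scalerA.
have saX : self_adjoint X.
  move=> _ [c ->]; exists c^*; apply/val_inj/funext => mu.
  by rewrite /= -[LHS]/((c * (mu setT)^*)^*) rmorphM /= conjcK.
have invX : invariant_subset T X by move=> mu f pmu Xf; rewrite TX.
have X1 : X (total_mass R S) by exists 1; rewrite scale1r.
(* Evaluation at a Dirac measure is a mean, and it is invariant on C.1 because the action fixes each
   element there. *)
have mX : invariant_mean_on T X (fun f => f d : C).
  split; last by move=> mu f pmu Xf; rewrite TX.
  split=> //; last by move=> f _ f0; exact: f0.
  split; first by move=> a f g _ _.
  exists 1 => f _; rewrite mul1r; apply: le_trans (dual_norm_bound f d) _.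
  by rewrite norm_positive_measure// d1 mulr1.
have [m' [[mm' im'] _]] := ext T translate_right_action
  translate_weakly_separately_continuous X linX saX invX X1 _ mX.
by exists m'; split=> // mu f pmu; exact: im'.
Qed.

End translation.

(** * From a topologically left invariant mean to the extension property *)

Section extension.
Context {R : realType} {S : ptopologicalType} {mul : S -> S -> S}.
Hypothesis S_hausdorff : hausdorff_space S.
Variable A : convolution_algebra R mul.
Local Notation C := (Cplx R).
Local Notation M := (regular_measure R S).
Variables (T : M -> topdual M -> topdual M).
Hypotheses (actT : right_action A T) (ctsT : weakly_separately_continuous T).
Implicit Types (mu nu : M) (f : topdual M).

Section orbit_functional.
Variable n : topdual M -> C.
Hypothesis bn : bounded_linear_functional n.

(** The map is a composite of the norm-to-weak continuous identity of M(S), the weakly continuous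
    orbit map and [n], weakly continuous as an element of the bidual. So it is norm continuous and
    linear, hence bounded. *)
Fact orbit_functional_subproof f : (fun mu => n (T mu f)) \in @dual_pred R M.
Proof.
have [linn _] := bn.
apply/asboolP/continuous0_bounded_linear.
  by move=> a mu nu; rewrite (action_linearl actT) linn.
have nd : n \in @dual_pred R (topdual M) by apply/asboolP.
have idC : continuous (id : M -> weak_topology M).
  by apply: continuous_to_weak => phi; exact: topdual_continuous.
apply: (@continuous_comp M (weak_topology M) C (id : M -> weak_topology M)
  (fun mu => n (T mu f))); first exact: idC.
apply: (@continuous_comp (weak_topology M) (weak_topology (topdual M)) C
  (fun mu => T mu f) n); first exact: ctsT.1.
exact: (@weak_eval_continuous R (topdual M) (Dual nd)).
Qed.

Definition orbit_functional f : topdual M := Dual (orbit_functional_subproof f).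

Lemma orbit_functional_linear (a : C) f g :
  orbit_functional (a *: f + g) = a *: orbit_functional f + orbit_functional g.
Proof.
have [linn _] := bn.
by apply/val_inj/funext => mu /=; rewrite (action_linearr actT) linn.
Qed.

Lemma orbit_functional_action nu f :
  orbit_functional (T nu f) = translate A (orbit_functional f) nu.
Proof. by apply/val_inj/funext => mu /=; rewrite (action_conv actT). Qed.

End orbit_functional.

Lemma invariant_mean_extension (X : set (topdual M)) (m m0 : topdual M -> C) :
  linear_subspace X -> self_adjoint X -> invariant_subset T X ->
  X (total_mass R S) -> invariant_mean_on T X m ->
  mean_on setT m0 -> topologically_left_invariant A m0 ->
  exists m' : topdual M -> C,
    invariant_mean_on T setT m' /\ forall f, X f -> m' f = m f.
Proof.
move=> linX saX invX X1 [[[linm _] posm m1] invm] [[linm0 _] posm0 m01] tli.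
have [X0 XD] := linX.
have [n [linn len nm]] := hahn_banach_complex (sup_reD S_hausdorff)
  (sup_reZ S_hausdorff) X0 XD linm
  (mean_le_sup_re S_hausdorff linX saX X1 linm posm m1).
have bn := dominated_bounded S_hausdorff linn len.
pose phi := orbit_functional bn.
(* For f in [X] the orbit stays in [X], where [n] agrees with [m] and [m] is invariant; so phi f
   takes the constant value m(f) on probabilities. *)
have phiX f : X f -> phi f = m f *: total_mass R S.
  move=> Xf; apply: topdual_eq_probability => mu pmu.
  rewrite -[RHS]/(m f * mu setT); have [_ ->] := pmu.
  by rewrite mulr1 /= nm ?invm//; exact: invX.
have m00 : m0 0 = 0.
  have := linm0 1 0 0 I I; rewrite scaler0 addr0 mul1r => h.
  by apply: (addrI (m0 0)); rewrite -h addr0.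
have m'X f : X f -> m0 (phi f) = m f.
  by move=> Xf; rewrite phiX// -[_ *: _]addr0 linm0// m01 m00 mulr1 addr0.
have linm' (a : C) f g : m0 (phi (a *: f + g)) = a * m0 (phi f) + m0 (phi g).
  by rewrite /phi orbit_functional_linear linm0.
have posm' f : nonneg_functional f -> 0 <= m0 (phi f).
  move=> f0; apply: posm0 => //; apply: nonneg_functional_probability => mu pmu.
  apply: (dominated_nonneg S_hausdorff linn len).
  exact: (action_nonneg actT).
have m'1 : m0 (phi (total_mass R S)) = 1 by rewrite m'X.
(* Boundedness is automatic: a positive normalized linear functional on all of M(S)^* lies below
   [sup_re]. *)
have [_ [k bk]] : bounded_linear_functional (fun f => m0 (phi f)).
  apply: (dominated_bounded S_hausdorff) => // f.
  by apply: (@mean_le_sup_re _ _ S_hausdorff setT (fun f => m0 (phi f))) => // g _;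
    exact: posm'.
exists (fun f => m0 (phi f)); split=> //; split.
  by split=> [|f _|//]; [split=> //; exists k|exact: posm'].
by move=> mu f pmu _; rewrite /phi orbit_functional_action tli.
Qed.

End extension.

Unset Implicit Arguments.

Theorem theorem3 (R : realType) (S : ptopologicalType) (mul : S -> S -> S)
    (S_semitop : semitopological_semigroup mul)
    (S_hausdorff : hausdorff_space S)
    (S_lc : locally_compact [set: S])
    (A : convolution_algebra R mul) :
  (exists m : topdual (regular_measure R S) -> Cplx R,
      mean_on setT m /\ topologically_left_invariant A m)
  <->
  (forall T : regular_measure R S -> topdual (regular_measure R S) ->
              topdual (regular_measure R S),
    right_action A T -> weakly_separately_continuous T ->
    forall X : set (topdual (regular_measure R S)),
      linear_subspace X -> self_adjoint X -> invariant_subset T X ->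
      X (total_mass R S) ->
      forall m : topdual (regular_measure R S) -> Cplx R,
        invariant_mean_on T X m ->
        exists m' : topdual (regular_measure R S) -> Cplx R,
          invariant_mean_on T setT m' /\ forall f, X f -> m' f = m f).
Proof.
split; last exact: extension_left_invariant.
move=> [m0 [mean_m0 tli_m0]] T actT ctsT X linX saX invX X1 m inv_m.
exact: (invariant_mean_extension S_hausdorff actT ctsT linX saX invX X1 inv_m
  mean_m0 tli_m0).
Qed.
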